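(* Let $(A,\mathfrak m)$ be a nonzero commutative local ring and let $R=\mathcal T(A)$. For all $R$-modules $M,N$ and all $i\ge1$, there is a natural isomorphism $$\mathrm{Tor}_i^R(M,N)\cong\mathrm{Tor}_i^A(M_A,N_A),$$ where the right-hand side is viewed as an $R$-module through $\pi$. In particular, $$\mathrm{fd}_R M=\mathrm{fd}_A M_A$$ for every $R$-module $M$, and $$\mathrm{w.gl.dim}\,R=\mathrm{w.gl.dim}\,A.$$
   Context: All rings are commutative with identity and all modules are unital. For a nonzero local ring $(A,\mathfrak m)$ (not necessarily Noetherian) with residue field $\kappa=A/\mathfrak m$ and residue map $a\mapsto\bar a$, define the ring, with coordinatewise operations, $$\mathcal T(A)=\{(a,(c_i)_{i\in\mathbb N})\in A\times\kappa^{\mathbb N}: c_i=\bar a\text{ for all but finitely many }i\},\quad \mathbb N=\{1,2,\ldots\}.$$ $\pi:\mathcal T(A)\to A$ is the surjective ring homomorphism $\pi(a,(c_i))=a$, and $J=\ker\pi$, so $R/J\cong A$. For an $R$-module $M$, $M_A=A\otimes_R M=M/JM$, an $A$-module. The flat dimension $\mathrm{fd}_B M\in\mathbb N_0\cup\{\infty\}$ is the least length of a flat resolution of $M$ ($\infty$ if none), with the convention $\mathrm{fd}_B 0=0$; $\mathrm{w.gl.dim}\,B=\sup_M\mathrm{fd}_B M$ over all $B$-modules $M$. *)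

(* Defs.v *)
From HB Require Import structures.
From mathcomp Require Import all_boot all_order all_algebra.
From mathcomp Require Import boolp classical_sets functions cardinality.
From mathcomp Require Import finmap.
From mathcomp.multinomials Require Import monalg.

Set Implicit Arguments.
Unset Strict Implicit.
Unset Printing Implicit Defensive.

Import GRing.Theory.

Local Open Scope ring_scope.
Local Open Scope quotient_scope.

Section Submodules.
Variables (R : pzRingType) (V W : lmodType R).

Inductive spanned (P : V -> Prop) : V -> Prop :=
| spanned0 : spanned P 0
| spannedD a x y : P x -> spanned P y -> spanned P (a *: x + y).

Definition span (P : V -> Prop) : {pred V} := fun x => `[< spanned P x >].

Lemma span_submod (P : V -> Prop) : GRing.subsemimod_closed (span P).
Proof.
split; first split.
- by apply/asboolP; exact: spanned0.
- move=> x y /asboolP Px /asboolP Py; apply/asboolP.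
  by elim: Px => [|a u v Pu _ IH]; rewrite ?add0r// -addrA; exact: spannedD.
- move=> a x /asboolP Px; apply/asboolP.
  elim: Px => [|b u v Pu _ IH]; first by rewrite scaler0; exact: spanned0.
  by rewrite scalerDr scalerA; exact: spannedD.
Qed.

HB.instance Definition _ (P : V -> Prop) :=
  GRing.isSubmodClosed.Build R V (span P) (span_submod P).

Lemma mem_span (P : V -> Prop) x : P x -> x \in span P.
Proof.
move=> Px; apply/asboolP; rewrite -[x]scale1r -[_ *: _]addr0.
by apply: spannedD => //; exact: spanned0.
Qed.

Lemma span_sub (P : V -> Prop) (S : submodClosed V) :
  (forall x, P x -> x \in S) -> {subset span P <= S}.
Proof.
move=> PS x /asboolP; elim=> [|a u v Pu _ IH]; first exact: rpred0.
by rewrite rpredD// rpredZ// PS.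
Qed.

Definition ker_pred (f : {linear V -> W}) : {pred V} := fun x => f x == 0.

Lemma ker_pred_submod (f : {linear V -> W}) :
  GRing.subsemimod_closed (ker_pred f).
Proof.
split; first split.
- by apply/eqP; rewrite raddf0.
- move=> x y /eqP fx /eqP fy; apply/eqP.
  by rewrite raddfD /= fx fy addr0.
- move=> a x /eqP fx; apply/eqP.
  by rewrite linearZ /= fx scaler0.
Qed.

HB.instance Definition _ (f : {linear V -> W}) :=
  GRing.isSubmodClosed.Build R V (ker_pred f) (ker_pred_submod f).

End Submodules.

Section Kernel.
Variables (R : pzRingType) (V W : lmodType R) (f : {linear V -> W}).

Definition kermod_type := {x : V | x \in ker_pred f}.
HB.instance Definition _ := SubChoice.on kermod_type.
HB.instance Definition _ := GRing.SubChoice_isSubLmodule.Build R V (ker_pred f)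
  kermod_type (ker_pred_submod f).
Definition kermod : lmodType R := kermod_type.

Definition ker_incl_fun (x : kermod) : V := val (x : kermod_type).
Lemma ker_incl_linear : linear ker_incl_fun.
Proof. by move=> a x y; rewrite /ker_incl_fun linearP. Qed.
HB.instance Definition _ :=
  GRing.isLinear.Build R kermod V *:%R ker_incl_fun ker_incl_linear.
Definition ker_incl : {linear kermod -> V} := ker_incl_fun.

Definition ker_elt (x : V) (fx0 : f x = 0) : kermod :=
  exist (fun x => x \in ker_pred f) x (introT eqP fx0).

Lemma ker_inclE (x : kermod) : f (ker_incl x) = 0.
Proof. exact/eqP/(valP (x : kermod_type)). Qed.
Lemma ker_incl_inj : injective ker_incl.
Proof. by move=> x y; exact: val_inj. Qed.
Lemma ker_eltK x (fx0 : f x = 0) : ker_incl (ker_elt fx0) = x.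
Proof. by []. Qed.

End Kernel.
Arguments ker_incl {R V W} f.

Section KernelMap.
Variables (R : pzRingType) (V W V' W' : lmodType R).
Variables (f : {linear V -> W}) (f' : {linear V' -> W'}) (h : {linear V -> V'}).

Definition maps_kernel := forall x, f x = 0 -> f' (h x) = 0.
Hypothesis hP : maps_kernel.

Definition ker_map_fun of maps_kernel : kermod f -> kermod f' :=
  fun x => ker_elt (hP (ker_inclE x)).
Lemma ker_map_linear : linear (ker_map_fun hP).
Proof.
by move=> a x y; apply: ker_incl_inj; rewrite linearP !ker_eltK !linearP.
Qed.
HB.instance Definition _ :=
  GRing.isLinear.Build R _ _ *:%R (ker_map_fun hP) ker_map_linear.
Definition ker_map : {linear kermod f -> kermod f'} := ker_map_fun hP.

Lemma ker_mapE x : ker_incl f' (ker_map x) = h (ker_incl f x).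
Proof. by []. Qed.

End KernelMap.

(* The Opaque commands below only keep unification from unfolding these
   constructions; they are used through the lemmas stated about them. *)
#[global] Opaque kermod ker_incl ker_elt ker_map.

Section Quotient.
Variables (R : pzRingType) (V : lmodType R).

(* Over a ring, a submodule predicate is also closed under opposites, which is
   what the library asks for in order to form the quotient group. *)
Definition subgroup_of (I : submodClosed V) : {pred V} := I.
Lemma subgroup_of_zmod (I : submodClosed V) : zmod_closed (subgroup_of I).
Proof.
split=> [|x y xI yI]; first exact: (rpred0 I).
by rewrite -scaleN1r; apply: (rpredD (S := I)) => //; exact: (rpredZ (s := I)).
Qed.
HB.instance Definition _ (I : submodClosed V) :=
  GRing.isZmodClosed.Build V (subgroup_of I) (subgroup_of_zmod I).

Variable I : submodClosed V.

Definition quotmod_type := Quotient.quot (subgroup_of I).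
HB.instance Definition _ := EqQuotient.on quotmod_type.
HB.instance Definition _ := ZmodQuotient.on quotmod_type.

Lemma quotmod_type_eq (x y : V) :
  x - y \in I -> \pi_quotmod_type x = \pi_quotmod_type y.
Proof. by move=> xyI; apply/eqP; rewrite -Quotient.idealrBE. Qed.
Lemma repr_quotmod (x : V) : x - repr (\pi_quotmod_type x) \in I.
Proof.
rewrite -[_ \in _]/(x - repr (\pi_quotmod_type x) \in subgroup_of I).
by rewrite Quotient.idealrBE reprK.
Qed.

Definition quot_scale (a : R) (x : quotmod_type) : quotmod_type :=
  \pi_quotmod_type (a *: repr x).
Lemma quot_scale_pi a (x : V) :
  quot_scale a (\pi_quotmod_type x) = \pi_quotmod_type (a *: x).
Proof.
apply/esym/quotmod_type_eq; rewrite -scalerBr.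
by apply: (rpredZ (s := I)); exact: repr_quotmod.
Qed.
Fact quot_scaleA a b x : quot_scale a (quot_scale b x) = quot_scale (a * b) x.
Proof.
by elim/quotW: x => x; rewrite (quot_scale_pi b x) !quot_scale_pi scalerA.
Qed.
Fact quot_scale1 : left_id 1 quot_scale.
Proof. by elim/quotW=> x; rewrite quot_scale_pi scale1r. Qed.
Fact quot_scaleDr : right_distributive quot_scale +%R.
Proof.
move=> a; elim/quotW=> x; elim/quotW=> y.
by rewrite -raddfD (quot_scale_pi a (x + y)) !quot_scale_pi -raddfD scalerDr.
Qed.
Fact quot_scaleDl x : {morph quot_scale^~ x : a b / a + b}.
Proof.
by elim/quotW: x => x a b; rewrite !quot_scale_pi -raddfD scalerDl.
Qed.
HB.instance Definition _ := GRing.Zmodule_isLmodule.Build R quotmod_type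
  quot_scaleA quot_scale1 quot_scaleDr quot_scaleDl.
Definition quotmod : lmodType R := quotmod_type.

Definition quot_pi_fun (x : V) : quotmod := \pi_quotmod_type x.
Lemma quot_pi_linear : linear quot_pi_fun.
Proof.
move=> a x y; rewrite /quot_pi_fun raddfD; congr (_ + _).
exact: esym (quot_scale_pi a x).
Qed.
HB.instance Definition _ :=
  GRing.isLinear.Build R V quotmod *:%R quot_pi_fun quot_pi_linear.
Definition quot_pi : {linear V -> quotmod} := quot_pi_fun.

Definition quot_repr (x : quotmod) : V := repr (x : quotmod_type).

Lemma quot_reprK x : quot_pi (quot_repr x) = x.
Proof. exact: reprK. Qed.
Lemma quot_pi_eq0 (x : V) : (quot_pi x = 0) <-> x \in I.
Proof.
split=> [x0|xI].
  rewrite -[x]subr0 -[_ \in _]/(x - 0 \in subgroup_of I) Quotient.idealrBE.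
  by apply/eqP; apply: (etrans x0); apply: esym; exact: (raddf0 quot_pi).
apply: etrans (raddf0 quot_pi).
by apply: quotmod_type_eq; rewrite subr0.
Qed.
Lemma quot_repr_pi (x : V) : quot_repr (quot_pi x) - x \in I.
Proof. by apply/quot_pi_eq0; rewrite linearB quot_reprK subrr. Qed.

End Quotient.
Arguments quot_pi {R V} I.
Arguments quot_repr {R V I} x.

Section QuotientMap.
Variables (R : pzRingType) (V W : lmodType R).
Variables (I : submodClosed V) (J : submodClosed W) (f : {linear V -> W}).

Definition maps_submod := forall x, x \in I -> f x \in J.
Hypothesis fIJ : maps_submod.

Definition quot_map_fun of maps_submod : quotmod I -> quotmod J :=
  fun x => quot_pi J (f (quot_repr x)).
Lemma quot_map_funE (x : V) :
  quot_map_fun fIJ (quot_pi I x) = quot_pi J (f x).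
Proof.
apply/eqP; rewrite -subr_eq0 -linearB -linearB; apply/eqP/quot_pi_eq0.
by apply: fIJ; exact: quot_repr_pi.
Qed.
Lemma quot_map_linear : linear (quot_map_fun fIJ).
Proof.
move=> a x y; rewrite -[x]quot_reprK -[y]quot_reprK -linearP.
by rewrite !quot_map_funE !linearP.
Qed.
HB.instance Definition _ := GRing.isLinear.Build R (quotmod I) (quotmod J) *:%R
  (quot_map_fun fIJ) quot_map_linear.
Definition quot_map : {linear quotmod I -> quotmod J} := quot_map_fun fIJ.

Lemma quot_mapE (x : V) : quot_map (quot_pi I x) = quot_pi J (f x).
Proof. exact: quot_map_funE. Qed.

End QuotientMap.
#[global] Opaque quotmod quot_pi quot_repr quot_map.

Section Homology.
Variables (R : pzRingType) (U V W : lmodType R).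
Variables (f : {linear U -> V}) (g : {linear V -> W}).

(* The elements of ker g that lie in the image of f. *)
Definition boundary : {pred kermod g} :=
  fun x => `[< exists u, f u = ker_incl g x >].

Lemma boundary_submod : GRing.subsemimod_closed boundary.
Proof.
split; first split.
- by apply/asboolP; exists 0; rewrite !linear0.
- move=> x y /asboolP[u fu] /asboolP[v fv]; apply/asboolP; exists (u + v).
  by rewrite !linearD fu fv.
- move=> a x /asboolP[u fu]; apply/asboolP; exists (a *: u).
  by rewrite !linearZ_LR fu.
Qed.
HB.instance Definition _ :=
  GRing.isSubmodClosed.Build R (kermod g) boundary boundary_submod.

Definition homology : lmodType R := quotmod boundary.

End Homology.
Arguments boundary {R U V W} f g _.

Section HomologyMap.
Variables (R : pzRingType) (U V W U' V' W' : lmodType R).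
Variables (f : {linear U -> V}) (g : {linear V -> W}).
Variables (f' : {linear U' -> V'}) (g' : {linear V' -> W'}).
Variables (hU : {linear U -> U'}) (hV : {linear V -> V'}) (hW : {linear W -> W'}).
Hypothesis hf : forall x, f' (hU x) = hV (f x).
Hypothesis hg : forall x, g' (hV x) = hW (g x).

Lemma homology_ker : maps_kernel g g' hV.
Proof. by move=> x gx0; rewrite hg gx0 linear0. Qed.

Lemma homology_boundary :
  maps_submod (boundary f g) (boundary f' g') (ker_map homology_ker).
Proof.
move=> x /asboolP[u fu]; apply/asboolP; exists (hU u).
by rewrite hf fu ker_mapE.
Qed.

Definition homology_map : {linear homology f g -> homology f' g'} :=
  quot_map homology_boundary.

End HomologyMap.
#[global] Opaque homology homology_map.

Section FreeModule.
Variables (R : nzRingType) (X : choiceType).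

Definition freemod : lmodType R := {malg R[X]}.
Definition basis (x : X) : freemod := << x >>.

Lemma freemod_sum (u : freemod) : u = \sum_(x <- msupp u) u@_x *: basis x.
Proof.
rewrite {1}(monalgE u); apply: eq_bigr => x _; apply/malgP => y.
by rewrite mcoeffZ !mcoeffU mulr_natr.
Qed.

Variable V : lmodType R.

Lemma free_ext (f g : {linear freemod -> V}) :
  (forall x, f (basis x) = g (basis x)) -> f =1 g.
Proof.
move=> fg u; rewrite (freemod_sum u) (linear_sum f) (linear_sum g).
by apply: eq_bigr => x _; rewrite !linearZ_LR fg.
Qed.

Variable h : X -> V.

Definition free_lift_fun (u : {malg R[X]}) : V := \sum_(x <- msupp u) u@_x *: h x.
Lemma free_lift_wide (u : {malg R[X]}) (D : {fset X}) :
  (msupp u `<=` D)%fset -> free_lift_fun u = \sum_(x <- D) u@_x *: h x.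
Proof.
move=> uD; rewrite /free_lift_fun (big_fset_incl _ uD)// => x _ xu.
by rewrite mcoeff_outdom// scale0r.
Qed.
Lemma free_lift_linear : linear free_lift_fun.
Proof.
move=> a u v; pose D := (msupp u `|` msupp v)%fset.
have uD : (msupp u `<=` D)%fset by exact: fsubsetUl.
have vD : (msupp v `<=` D)%fset by exact: fsubsetUr.
have uvD : (msupp (a *: u + v) `<=` D)%fset.
  apply: (fsubset_trans (msuppD_le _ _)); rewrite fsubUset vD andbT.
  exact: fsubset_trans (msuppZ_le _ _) uD.
rewrite (free_lift_wide uD) (free_lift_wide vD) (free_lift_wide uvD).
rewrite scaler_sumr -big_split; apply: eq_bigr => x _ /=.
by rewrite mcoeffD mcoeffZ scalerDl scalerA.
Qed.
HB.instance Definition _ := GRing.isLinear.Build R {malg R[X]} V *:%R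
  free_lift_fun free_lift_linear.

(* The linear extension of h. *)
Definition free_lift : {linear freemod -> V} := free_lift_fun.

Lemma free_liftE x : free_lift (basis x) = h x.
Proof.
apply: (etrans (free_lift_wide msuppU_le)).
by rewrite big_seq_fset1 mcoeffU eqxx; exact: scale1r.
Qed.

End FreeModule.

Definition free_map (R : nzRingType) (X Y : choiceType) (h : X -> Y) :
  {linear freemod R X -> freemod R Y} := free_lift (fun x => basis R (h x)).

Lemma free_mapE (R : nzRingType) (X Y : choiceType) (h : X -> Y) x :
  free_map R h (basis R x) = basis R (h x).
Proof. exact: free_liftE. Qed.

#[global] Opaque freemod basis free_lift free_map.

Section Tensor.
Variables (R : comNzRingType) (M N : lmodType R).

Local Notation F := (freemod R (M * N)%type).
Definition pair_basis (x : M) (y : N) : F := basis R (x, y).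
Local Notation "[ x , y ]" := (pair_basis x y).

Inductive bilinear_rel : F -> Prop :=
| bilinearDl x x' y : bilinear_rel ([x + x', y] - [x, y] - [x', y])
| bilinearDr x y y' : bilinear_rel ([x, y + y'] - [x, y] - [x, y'])
| bilinearZl a x y : bilinear_rel ([a *: x, y] - a *: [x, y])
| bilinearZr a x y : bilinear_rel ([x, a *: y] - a *: [x, y]).

Definition tensor : lmodType R := quotmod (span bilinear_rel).

Definition pure (x : M) (y : N) : tensor := quot_pi _ [x, y].

Lemma pureDl x x' y : pure (x + x') y = pure x y + pure x' y.
Proof.
apply/eqP; rewrite -subr_eq0 opprD addrA -!linearB; apply/eqP/quot_pi_eq0.
by apply: mem_span; exact: bilinearDl.
Qed.
Lemma pureDr x y y' : pure x (y + y') = pure x y + pure x y'.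
Proof.
apply/eqP; rewrite -subr_eq0 opprD addrA -!linearB; apply/eqP/quot_pi_eq0.
by apply: mem_span; exact: bilinearDr.
Qed.
Lemma pureZl a x y : pure (a *: x) y = a *: pure x y.
Proof.
apply/eqP; rewrite -subr_eq0 -linearZ_LR -linearB; apply/eqP/quot_pi_eq0.
by apply: mem_span; exact: bilinearZl.
Qed.
Lemma pureZr a x y : pure x (a *: y) = a *: pure x y.
Proof.
apply/eqP; rewrite -subr_eq0 -linearZ_LR -linearB; apply/eqP/quot_pi_eq0.
by apply: mem_span; exact: bilinearZr.
Qed.

Lemma tensor_ext (V : lmodType R) (f g : {linear tensor -> V}) :
  (forall x y, f (pure x y) = g (pure x y)) -> f =1 g.
Proof.
move=> fg t; rewrite -[t]quot_reprK; set u := quot_repr t.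
pose q := quot_pi (span bilinear_rel).
have fgq : (f \o q : {linear _ -> _}) =1 (g \o q : {linear _ -> _}).
  by apply: free_ext => -[x y]; exact: fg.
exact: fgq u.
Qed.

End Tensor.

Section TensorMap.
Variables (R : comNzRingType) (M M' N N' : lmodType R).
Variables (f : {linear M -> M'}) (g : {linear N -> N'}).

Let fg : {linear freemod R (M * N)%type -> freemod R (M' * N')%type} :=
  free_map R (fun z => (f z.1, g z.2)).

Let fgE x y : fg (pair_basis x y) = pair_basis (f x) (g y).
Proof. exact: free_mapE. Qed.

Lemma tensor_map_rel :
  maps_submod (span (@bilinear_rel R M N)) (span (@bilinear_rel R M' N')) fg.
Proof.
move=> u /asboolP; elim=> [|a x y xrel _ IH]; first by rewrite linear0 rpred0.
rewrite linearP; apply: rpredD => //; apply: rpredZ; apply: mem_span.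
case: xrel => [x1 x2 z|z x1 x2|b x1 z|b z x1].
- by rewrite !linearB !fgE linearD; exact: bilinearDl.
- by rewrite !linearB !fgE linearD; exact: bilinearDr.
- by rewrite linearB linearZ_LR !fgE linearZ_LR; exact: bilinearZl.
- by rewrite linearB linearZ_LR !fgE linearZ_LR; exact: bilinearZr.
Qed.

Definition tensor_map : {linear tensor M N -> tensor M' N'} :=
  quot_map tensor_map_rel.

Lemma tensor_mapE x y : tensor_map (pure x y) = pure (f x) (g y).
Proof. by rewrite [LHS]quot_mapE fgE. Qed.

End TensorMap.
#[global] Opaque tensor pure tensor_map.

Section TensorMapTheory.
Variable R : comNzRingType.

Lemma tensor_map_comp (M1 M2 M3 N1 N2 N3 : lmodType R)
    (f : {linear M1 -> M2}) (f' : {linear M2 -> M3})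
    (g : {linear N1 -> N2}) (g' : {linear N2 -> N3}) t :
  tensor_map f' g' (tensor_map f g t) = tensor_map (f' \o f) (g' \o g) t.
Proof.
have E : (tensor_map f' g' \o tensor_map f g : {linear _ -> _}) =1
         tensor_map (f' \o f) (g' \o g).
  by apply: tensor_ext => x y; rewrite /= !tensor_mapE.
exact: E t.
Qed.

Lemma eq_tensor_map (M M' N N' : lmodType R)
    (f f' : {linear M -> M'}) (g g' : {linear N -> N'}) :
  f =1 f' -> g =1 g' -> tensor_map f g =1 tensor_map f' g'.
Proof.
by move=> ff' gg'; apply: tensor_ext => x y; rewrite !tensor_mapE ff' gg'.
Qed.

Lemma tensor_map_id (M N : lmodType R) (t : tensor M N) :
  tensor_map idfun idfun t = t.
Proof.
have E : tensor_map idfun idfun =1 (idfun : {linear tensor M N -> _}).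
  by apply: tensor_ext => x y; rewrite tensor_mapE.
exact: E t.
Qed.

Lemma tensor_mapDl (M M' N N' : lmodType R)
    (f f' : {linear M -> M'}) (g : {linear N -> N'}) t :
  tensor_map (f \+ f') g t = tensor_map f g t + tensor_map f' g t.
Proof.
have E : tensor_map (f \+ f') g =1
         (tensor_map f g \+ tensor_map f' g : {linear _ -> _}).
  by apply: tensor_ext => x y; rewrite /= !tensor_mapE; exact: pureDl.
exact: E t.
Qed.

End TensorMapTheory.

Section Resolution.
Variable R : comNzRingType.

Definition aug (M : lmodType R) : {linear freemod R M -> M} :=
  free_lift (fun x : M => x).

Fixpoint syz n (M : lmodType R) : lmodType R :=
  if n is n'.+1 then kermod (aug (syz n' M)) else M.

(* The canonical free resolution of M: its n-th term is the free module on the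
   underlying set of the n-th syzygy, the 0-th syzygy being M. *)
Definition res n (M : lmodType R) : lmodType R := freemod R (syz n M).

Definition syz_d (M : lmodType R) :
    {linear freemod R (kermod (aug M)) -> freemod R M} :=
  ker_incl (aug M) \o aug (kermod (aug M)).

Lemma syz_dE (M : lmodType R) u :
  syz_d M u = ker_incl (aug M) (aug (kermod (aug M)) u).
Proof. by []. Qed.

Definition res_d n (M : lmodType R) : {linear res n.+1 M -> res n M} :=
  syz_d (syz n M).

Lemma aug_map (M M' : lmodType R) (f : {linear M -> M'}) u :
  aug M' (free_map R f u) = f (aug M u).
Proof.
have E : (aug M' \o free_map R f : {linear _ -> _}) =1
         (f \o aug M : {linear _ -> _}).
  by apply: free_ext => x; rewrite /= free_mapE !free_liftE.
exact: E u.
Qed.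

Lemma aug_map_ker (M M' : lmodType R) (f : {linear M -> M'}) :
  maps_kernel (aug M) (aug M') (free_map R f).
Proof. by move=> u u0; rewrite aug_map u0 linear0. Qed.

Fixpoint syz_map n (M M' : lmodType R) (f : {linear M -> M'}) :
    {linear syz n M -> syz n M'} :=
  if n is n'.+1 then ker_map (aug_map_ker (syz_map n' f)) else f.

Definition res_map n (M M' : lmodType R) (f : {linear M -> M'}) :
  {linear res n M -> res n M'} := free_map R (syz_map n f).

Lemma syz_d_map (M M' : lmodType R) (f : {linear M -> M'}) u :
  syz_d M' (free_map R (ker_map (aug_map_ker f)) u) = free_map R f (syz_d M u).
Proof.
by rewrite !syz_dE aug_map ker_mapE.
Qed.

Lemma res_map_d n (M M' : lmodType R) (f : {linear M -> M'}) u :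
  res_d n M' (res_map n.+1 f u) = res_map n f (res_d n M u).
Proof. exact: (syz_d_map (syz_map n f) u). Qed.

End Resolution.
Arguments aug {R} M.
Arguments res_d {R} n M.
Arguments res_map {R} n {M M'} f.

Section Tor.
Variable R : comNzRingType.

(* The differential out of degree i of the complex res _ M (x) N; the complex
   is 0 in negative degrees, so the differential out of degree 0 is null. *)
Definition tor_d i (M N : lmodType R) :
    {linear tensor (res i M) N -> tensor (res i.-1 M) N} :=
  match i return {linear tensor (res i M) N -> tensor (res i.-1 M) N} with
  | 0 => \0
  | i'.+1 => tensor_map (res_d i' M) idfun
  end.

Arguments tor_d : clear implicits.

Definition Tor i (M N : lmodType R) : lmodType R :=
  homology (tor_d i.+1 M N) (tor_d i M N).

Variables (i : nat) (M M' N N' : lmodType R).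
Variables (f : {linear M -> M'}) (g : {linear N -> N'}).

Lemma tor_d_map j t :
  tor_d j M' N' (tensor_map (res_map j f) g t)
  = tensor_map (res_map j.-1 f) g (tor_d j M N t).
Proof.
case: j t => [|j] t; first by rewrite [LHS]/= [X in tensor_map _ _ X]/= linear0.
rewrite [LHS]tensor_map_comp [RHS]tensor_map_comp.
by apply: eq_tensor_map => u //; exact: res_map_d.
Qed.

Definition Tor_map : {linear Tor i M N -> Tor i M' N'} :=
  homology_map (@tor_d_map i.+1) (@tor_d_map i).

End Tor.
Arguments tor_d {R} i M N.
Arguments Tor_map {R} i {M M' N N'} f g.

Section Restriction.
Variables (S R : comNzRingType) (phi : {rmorphism S -> R}).

Section Module.
Variable V : lmodType R.

Definition restr_type of {rmorphism S -> R} : Type := V.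
Local Notation W := (restr_type phi).
HB.instance Definition _ := GRing.Zmodule.on W.

Definition restr_scale (a : S) (x : W) : W := phi a *: (x : V).
Fact restr_scaleA a b x : restr_scale a (restr_scale b x) = restr_scale (a * b) x.
Proof. by rewrite /restr_scale scalerA rmorphM. Qed.
Fact restr_scale1 : left_id 1 restr_scale.
Proof. by move=> x; rewrite /restr_scale rmorph1 scale1r. Qed.
Fact restr_scaleDr : right_distributive restr_scale +%R.
Proof. by move=> a x y; exact: scalerDr. Qed.
Fact restr_scaleDl x : {morph restr_scale^~ x : a b / a + b}.
Proof. by move=> a b; rewrite /restr_scale rmorphD scalerDl. Qed.
HB.instance Definition _ := GRing.Zmodule_isLmodule.Build S W
  restr_scaleA restr_scale1 restr_scaleDr restr_scaleDl.

(* V viewed as an S-module through phi. *)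
Definition restr_scalars : lmodType S := W.
End Module.

Section Map.
Variables (V V' : lmodType R) (h : {linear V -> V'}).

Definition restr_map_fun (x : restr_scalars V) : restr_scalars V' := h x.
Lemma restr_map_linear : linear restr_map_fun.
Proof. by move=> a x y; exact: (linearP h). Qed.
HB.instance Definition _ :=
  GRing.isLinear.Build S _ _ *:%R restr_map_fun restr_map_linear.
Definition restr_map : {linear restr_scalars V -> restr_scalars V'} :=
  restr_map_fun.
End Map.

End Restriction.
Arguments restr_map {S R} phi {V V'} h.

Section Extension.
Variables (S R : comNzRingType) (phi : {rmorphism S -> R}).

Definition phi_ring : lmodType S := restr_scalars phi (R^o : lmodType R).

(* Multiplication by a on R, as an S-linear map. *)
Definition mul_by_fun (a : R) (x : phi_ring) : phi_ring := a * (x : R).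
Lemma mul_by_linear a : linear (mul_by_fun a).
Proof.
by move=> b x y; rewrite /mul_by_fun mulrDr; congr (_ + _); exact: mulrCA.
Qed.
HB.instance Definition _ a :=
  GRing.isLinear.Build S _ _ *:%R (mul_by_fun a) (mul_by_linear a).
Definition mul_by a : {linear phi_ring -> phi_ring} := mul_by_fun a.

Section Module.
Variable M : lmodType S.

Definition ext_type : Type := tensor phi_ring M.
HB.instance Definition _ := GRing.Zmodule.on ext_type.

Definition ext_scale (a : R) : ext_type -> ext_type := tensor_map (mul_by a) idfun.
Fact ext_scaleA a b x : ext_scale a (ext_scale b x) = ext_scale (a * b) x.
Proof.
apply: (etrans (tensor_map_comp _ _ _ _ _)).
by apply: eq_tensor_map => // u; exact: mulrA.
Qed.
Fact ext_scale1 : left_id 1 ext_scale.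
Proof.
move=> x; apply: etrans (tensor_map_id x); apply: eq_tensor_map => // u.
exact: mul1r.
Qed.
Fact ext_scaleDr : right_distributive ext_scale +%R.
Proof. by move=> a x y; exact: linearD. Qed.
Fact ext_scaleDl x : {morph ext_scale^~ x : a b / a + b}.
Proof.
move=> a b; apply: etrans (tensor_mapDl _ _ _ _); apply: eq_tensor_map => // u.
exact: mulrDl.
Qed.
HB.instance Definition _ := GRing.Zmodule_isLmodule.Build R ext_type
  ext_scaleA ext_scale1 ext_scaleDr ext_scaleDl.

(* R (x)_S M, on which R acts through its left factor. *)
Definition ext_scalars : lmodType R := ext_type.
End Module.

Section Map.
Variables (M M' : lmodType S) (f : {linear M -> M'}).

Definition ext_map_fun (x : ext_scalars M) : ext_scalars M' :=
  tensor_map (idfun : {linear phi_ring -> phi_ring}) f x.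
Lemma ext_map_linear : linear ext_map_fun.
Proof.
move=> a x y; apply: (etrans (linearD _ _ _)); congr (_ + _).
apply: (etrans (tensor_map_comp _ _ _ _ _)).
by apply: esym; apply: (etrans (tensor_map_comp _ _ _ _ _)); exact: eq_tensor_map.
Qed.
HB.instance Definition _ :=
  GRing.isLinear.Build R _ _ *:%R ext_map_fun ext_map_linear.
Definition ext_map : {linear ext_scalars M -> ext_scalars M'} := ext_map_fun.
End Map.

End Extension.
Arguments ext_map {S R} phi {M M'} f.

(* The least natural number satisfying P, None standing for infinity. *)
Definition least (P : nat -> Prop) : option nat :=
  match pselect (exists n, `[< P n >]) with
  | left exP => Some (ex_minn exP)
  | right _ => None
  end.

Section FlatDimension.
Variable R : comNzRingType.

Definition flat (M : lmodType R) : Prop :=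
  forall (N N' : lmodType R) (f : {linear N -> N'}),
    injective f -> injective (tensor_map (idfun : {linear M -> M}) f).

Definition flat_resolution_of_length (M : lmodType R) (n : nat) : Prop :=
  exists (F : nat -> lmodType R) (e : {linear F 0 -> M})
         (d : forall i, {linear F i.+1 -> F i}),
  [/\ forall i, flat (F i),
      forall i, (n < i)%N -> forall x : F i, x = 0,
      forall y, exists x, e x = y,
      forall x, e x = 0 <-> exists y, d 0 y = x &
      forall i x, d i x = 0 <-> exists y, d i.+1 y = x].

Definition fd (M : lmodType R) : option nat :=
  least (flat_resolution_of_length M).

(* The supremum of the fd M in the natural numbers extended with infinity is
   their least upper bound. *)
Definition wgldim : option nat :=
  least (fun n => forall M : lmodType R, exists2 k, fd M = Some k & (k <= n)%N).

End FlatDimension.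

Section LocalRing.
Variable A : comNzRingType.

(* The terms of idealr A are the proper ideals. *)
Definition maximal_ideal (m : idealr A) : Prop :=
  forall I : idealr A, {subset m <= I} -> {subset I <= m}.

Definition local_ring (m : idealr A) : Prop :=
  maximal_ideal m /\ forall I : idealr A, maximal_ideal I -> I =i m.

Variable m : idealr A.

Definition residue (a : A) : {ideal_quot m} := \pi_{ideal_quot m} a.

Lemma residueB a b : residue (a - b) = residue a - residue b.
Proof. exact: rmorphB. Qed.
Lemma residueM a b : residue (a * b) = residue a * residue b.
Proof. exact: rmorphM. Qed.

(* The sequences of the ring are indexed by nat, i.e. from 0. *)
Definition deviation (x : A * (nat -> {ideal_quot m})) : set nat :=
  [set i | x.2 i <> residue x.1]%classic.

Definition TA_pred : {pred A * (nat -> {ideal_quot m})} :=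
  fun x => `[< finite_set (deviation x) >].

Lemma TA_subring : subring_closed TA_pred.
Proof.
split.
- apply/asboolP; rewrite (_ : deviation _ = set0)//.
  apply/seteqP; split=> // i /=; apply.
  exact: esym (rmorph1 \pi_{ideal_quot m}).
- move=> x y /asboolP fx /asboolP fy; apply/asboolP.
  have /sub_finite_set: finite_set (deviation x `|` deviation y)%classic.
    by rewrite finite_setU.
  apply=> i /=; apply: contra_notP => /not_orP[/contrapT xi /contrapT yi].
  by rewrite [RHS](residueB x.1 y.1) -xi -yi.
- move=> x y /asboolP fx /asboolP fy; apply/asboolP.
  have /sub_finite_set: finite_set (deviation x `|` deviation y)%classic.
    by rewrite finite_setU.
  apply=> i /=; apply: contra_notP => /not_orP[/contrapT xi /contrapT yi].
  by rewrite [RHS](residueM x.1 y.1) -xi -yi.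
Qed.
HB.instance Definition _ := GRing.isSubringClosed.Build
  (A * (nat -> {ideal_quot m}))%type TA_pred TA_subring.

Definition TA_type := {x : A * (nat -> {ideal_quot m}) | x \in TA_pred}.
HB.instance Definition _ := SubChoice.on TA_type.
HB.instance Definition _ := [SubChoice_isSubComNzRing of TA_type by <:].
Definition TA : comNzRingType := TA_type.

Definition TA_proj_fun (x : TA) : A := (val (x : TA_type)).1.
Lemma TA_proj_zmod : zmod_morphism TA_proj_fun.
Proof. by []. Qed.
Lemma TA_proj_monoid : monoid_morphism TA_proj_fun.
Proof. by []. Qed.
HB.instance Definition _ :=
  GRing.isZmodMorphism.Build TA A TA_proj_fun TA_proj_zmod.
HB.instance Definition _ :=
  GRing.isMonoidMorphism.Build TA A TA_proj_fun TA_proj_monoid.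
Definition TA_proj : {rmorphism TA -> A} := TA_proj_fun.

End LocalRing.

(* Main.v *)
(* J = ker pi is a sum of copies of the residue field, each generated by an
   idempotent e.  Since e R is a field, every injection f : N -> N' has a partial
   retraction g with g (f x) = e x; hence J annihilates the kernel of
   N (x) L -> N' (x) L.  Balancing Tor over free covers of both arguments, the
   chain map from the canonical resolution of M to that of ext M induces
   isomorphisms on Tor_i for i >= 1: the induction starts with the comparison of
   ker (M (x) L -> M (x) G) with its reduction modulo J, for L -> G injective.
   On the A side all tensor products are taken over R, as Q (x)_A ext N is
   Q (x)_R N.  Likewise M is R-flat iff ext M is A-flat, and a flat cover of ext M
   over A pulls back along M -> ext M to a flat cover of M with the same kernel,
   which compares flat dimensions without using Tor. *)
From HB Require Import structures.
From mathcomp Require Import all_boot all_order all_algebra.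
From mathcomp Require Import boolp classical_sets cardinality.
From mathcomp Require Import finmap.
Require Import Defs.

Set Implicit Arguments.
Unset Strict Implicit.
Unset Printing Implicit Defensive.

Import GRing.Theory.

Local Open Scope ring_scope.

(** An element t of a kernel of N ⊗ L -> N' ⊗ L is killed by J; if it also vanishes modulo J, it
    satisfies r t = t for some r in J, hence t = 0. Both the Tor comparison and the descent of
    flatness rest on this clash. The retractions exist because e N' is a vector space over e R (0 or
    a field), so Zorn's lemma gives complements. The obstacle on the Tor side is that the canonical
    resolution does not commute with base change: the n-th term for ext M is free over A on a syzygy
    of ext M, not on a syzygy of M, so nothing is bijective at chain level. Bijectivity is therefore
    proved on the kernels that compute Tor_1 of the successive syzygies. Each such kernel has one
    description that resolves the first argument and one that resolves the second, and the induction
    alternates between them. Degree 0 is out of reach: M ⊗ N and its reduction modulo J differ in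
    general. *)

Lemma inj_surj_bij (T U : Type) (f : T -> U) :
  injective f -> (forall y, exists x, f x = y) -> bijective f.
Proof.
move=> fi fs; pose g y := sval (cid (fs y)).
have gK : cancel g f by move=> y; exact: svalP (cid (fs y)).
by exists g => // x; apply: fi; rewrite gK.
Qed.

Lemma bij_surj (T U : Type) (f : T -> U) : bijective f -> forall y, exists x, f x = y.
Proof. by case=> g _ gK y; exists (g y). Qed.

(** * Tensor products *)

Section QuotLift.
Variables (R : pzRingType) (V W : lmodType R) (I : submodClosed V).
Variable f : {linear V -> W}.

Definition vanishes_on := forall x, x \in I -> f x = 0.
Hypothesis fI : vanishes_on.

(** The vanishing proof is a dummy argument, so that the linear structure declared below can be
    recovered from the term itself. *)
Definition quot_lift_fun of vanishes_on : quotmod I -> W :=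
  fun x => f (quot_repr x).
Lemma quot_lift_funE (x : V) : quot_lift_fun fI (quot_pi I x) = f x.
Proof.
by apply/eqP; rewrite -subr_eq0 -linearB fI//; exact: quot_repr_pi.
Qed.
Lemma quot_lift_linear : linear (quot_lift_fun fI).
Proof.
move=> a x y; rewrite -[x]quot_reprK -[y]quot_reprK -linearP.
by rewrite !quot_lift_funE linearP.
Qed.
HB.instance Definition _ := GRing.isLinear.Build R (quotmod I) W *:%R
  (quot_lift_fun fI) quot_lift_linear.
Definition quot_lift : {linear quotmod I -> W} := quot_lift_fun fI.

Lemma quot_liftE (x : V) : quot_lift (quot_pi I x) = f x.
Proof. exact: quot_lift_funE. Qed.

End QuotLift.

Section TensorLift.
Variables (R : comNzRingType) (M N V : lmodType R).

Local Transparent tensor pure.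

Variable b : M -> N -> V.

Definition bilinear_map :=
  (forall y, linear (b^~ y)) /\ (forall x, linear (b x)).
Hypothesis bP : bilinear_map.

Let h : {linear freemod R (M * N)%type -> V} := free_lift (fun z => b z.1 z.2).

Let hE x y : h (pair_basis x y) = b x y.
Proof. exact: free_liftE. Qed.

Lemma tensor_lift_vanishes : vanishes_on (span (@bilinear_rel R M N)) h.
Proof.
case: bP => bl br.
have bDl x x' y : b (x + x') y = b x y + b x' y.
  by have := bl y 1 x x'; rewrite !scale1r.
have bDr x y y' : b x (y + y') = b x y + b x y'.
  by have := br x 1 y y'; rewrite !scale1r.
have b0l y : b 0 y = 0 by apply: (addrI (b 0 y)); rewrite -bDl !addr0.
have b0r x : b x 0 = 0 by apply: (addrI (b x 0)); rewrite -bDr !addr0.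
move=> u /asboolP; elim=> [|a x y xrel _ IH]; first by rewrite linear0.
rewrite linearP IH addr0; suff -> : h x = 0 by rewrite scaler0.
case: xrel => [x1 x2 z|z x1 x2|c x1 z|c z x1].
- by rewrite !linearB !hE bDl addrAC addrK subrr.
- by rewrite !linearB !hE bDr addrAC addrK subrr.
- rewrite linearB linearZ_LR !hE; have := bl z c x1 0.
  by rewrite /= !addr0 b0l addr0 => ->; rewrite subrr.
- rewrite linearB linearZ_LR !hE; have := br z c x1 0.
  by rewrite /= !addr0 b0r addr0 => ->; rewrite subrr.
Qed.

Definition tensor_lift : {linear tensor M N -> V} :=
  quot_lift tensor_lift_vanishes.

Lemma tensor_liftE x y : tensor_lift (pure x y) = b x y.
Proof. by rewrite [LHS]quot_liftE hE. Qed.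

End TensorLift.
#[global] Opaque quot_lift tensor_lift.

Section TensorTheory.
Variable R : comNzRingType.
Implicit Types M N V : lmodType R.

Lemma pure0l M N (y : N) : pure (0 : M) y = 0.
Proof. by apply: (addrI (pure 0 y)); rewrite -pureDl !addr0. Qed.

Lemma pure0r M N (x : M) : pure x (0 : N) = 0.
Proof. by apply: (addrI (pure x 0)); rewrite -pureDr !addr0. Qed.

Lemma pure_linearl M N (y : N) : linear (fun x : M => pure x y).
Proof. by move=> a x x'; rewrite pureDl pureZl. Qed.

Lemma pure_linearr M N (x : M) : linear (fun y : N => pure x y).
Proof. by move=> a y y'; rewrite pureDr pureZr. Qed.

(** Finite sums of pure tensors form a submodule, scalars being absorbed by the left factor. The
    projection to its quotient agrees with 0 on pure tensors, hence everywhere. *)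
Lemma tensor_ind M N (P : tensor M N -> Prop) :
  P 0 -> (forall x y t, P t -> P (pure x y + t)) -> forall t, P t.
Proof.
move=> P0 PD.
suff H t : exists l : seq (M * N), t = \sum_(z <- l) pure z.1 z.2.
  move=> t; have [l ->] := H t; elim: l => [|z l IH]; first by rewrite big_nil.
  by rewrite big_cons; exact: PD.
pose I : {pred tensor M N} :=
  fun t => `[< exists l : seq (M * N), t = \sum_(z <- l) pure z.1 z.2 >].
have IP : GRing.subsemimod_closed I.
  split; first split.
  - by apply/asboolP; exists [::]; rewrite big_nil.
  - move=> u v /asboolP[k ->] /asboolP[l ->]; apply/asboolP; exists (k ++ l).
    by rewrite big_cat.
  - move=> a u /asboolP[k ->]; apply/asboolP; exists [seq (a *: z.1, z.2) | z <- k].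
    by rewrite big_map scaler_sumr; apply: eq_bigr => z _; rewrite pureZl.
pose Im := GRing.isSubmodClosed.Build R (tensor M N) I IP.
pose J : submodClosed (tensor M N) := HB.pack I Im.
have : quot_pi J =1 (\0 : {linear tensor M N -> quotmod J}).
  apply: tensor_ext => x y; apply/quot_pi_eq0.
  by apply/asboolP; exists [:: (x, y)]; rewrite big_seq1.
by move=> /(_ t)/quot_pi_eq0/asboolP.
Qed.

Definition tensor_swap M N : {linear tensor M N -> tensor N M} :=
  tensor_lift (conj (@pure_linearr N M) (@pure_linearl N M)
    : bilinear_map (fun x y => pure y x)).

Lemma tensor_swapE M N (x : M) (y : N) : tensor_swap M N (pure x y) = pure y x.
Proof. exact: tensor_liftE. Qed.

Lemma tensor_swapK M N : cancel (@tensor_swap M N) (@tensor_swap N M).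
Proof.
move=> t; have := @tensor_ext _ _ _ _ (tensor_swap N M \o tensor_swap M N) idfun.
by apply=> x y; rewrite /= !tensor_swapE.
Qed.

Lemma tensor_map_swap M M' N N' (f : {linear M -> M'}) (g : {linear N -> N'}) t :
  tensor_map f g (tensor_swap N M t) = tensor_swap N' M' (tensor_map g f t).
Proof.
have := @tensor_ext _ _ _ _
  (tensor_map f g \o tensor_swap N M) (tensor_swap N' M' \o tensor_map g f).
by apply=> x y; rewrite /= !tensor_swapE !tensor_mapE tensor_swapE.
Qed.

Lemma tensor_map_surj M M' N N' (f : {linear M -> M'}) (g : {linear N -> N'}) :
  (forall y, exists x, f x = y) -> (forall y, exists x, g x = y) ->
  forall t, exists u, tensor_map f g u = t.
Proof.
move=> fs gs; apply: tensor_ind => [|x y t [u <-]].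
  by exists 0; rewrite linear0.
have [[a <-] [b <-]] := (fs x, gs y).
by exists (pure a b + u); rewrite linearD tensor_mapE.
Qed.

(** [flat] puts the module on the left; the swap moves it to the right, where the kernels studied
    below have it. *)
Lemma flat_right M N N' (f : {linear N -> N'}) : flat M -> injective f ->
  injective (tensor_map f (idfun : {linear M -> M})).
Proof.
move=> fM fi t u tu; apply: (can_inj (@tensor_swapK _ _)).
apply: (fM _ _ _ fi); apply: etrans (tensor_map_swap _ _ _) _.
by rewrite tu; apply: esym; exact: tensor_map_swap.
Qed.

Lemma flat_of_right M :
  (forall N N' (f : {linear N -> N'}), injective f ->
    injective (tensor_map f (idfun : {linear M -> M}))) -> flat M.
Proof.
move=> H N N' f fi t u tu; apply: (can_inj (@tensor_swapK _ _)).
apply: (H _ _ _ fi); apply: etrans (tensor_map_swap _ _ _) _.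
by rewrite tu; apply: esym; exact: tensor_map_swap.
Qed.

End TensorTheory.
Arguments tensor_swap {R M N}.

Section RightExactness.
Variables (R : comNzRingType) (K M M' L : lmodType R).
Variables (i : {linear K -> M}) (q : {linear M -> M'}).
Hypothesis q_surj : forall y, exists x, q x = y.
Hypothesis exact_iq : forall x, q x = 0 -> exists k, i k = x.

Let im : {pred tensor M L} := fun t => `[< exists u, tensor_map i idfun u = t >].

Let im_submod : GRing.subsemimod_closed im.
Proof.
split; first split.
- by apply/asboolP; exists 0; rewrite linear0.
- move=> _ _ /asboolP[u <-] /asboolP[v <-]; apply/asboolP; exists (u + v).
  by rewrite linearD.
- by move=> a _ /asboolP[u <-]; apply/asboolP; exists (a *: u); rewrite linearZ_LR.
Qed.
HB.instance Definition _ := GRing.isSubmodClosed.Build R (tensor M L) im im_submod.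

Lemma tensor_right_exact (t : tensor M L) :
  tensor_map q idfun t = 0 -> exists u, tensor_map i idfun u = t.
Proof.
(* An inverse of the map induced by q on the cokernel of i ⊗ L: lift y through q by choice. Two
   lifts differ by some i k, so modulo the image the choice does not matter, and the assignment is
   bilinear. *)
pose r (y : M') : M := sval (cid (q_surj y)).
have rK y : q (r y) = y := svalP (cid (q_surj y)).
pose b (y : M') (l : L) : quotmod im := quot_pi im (pure (r y) l).
have piE x x' l : q x = q x' -> quot_pi im (pure x l) = quot_pi im (pure x' l).
  move=> xx'; apply/eqP; rewrite -subr_eq0 -linearB; apply/eqP/quot_pi_eq0.
  have [|k ik] := @exact_iq (x - x'); first by rewrite linearB xx' subrr.
  apply/asboolP; exists (pure k l); rewrite tensor_mapE ik.
  by rewrite -scaleN1r pureDl pureZl scaleN1r.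
have bP : bilinear_map b.
  split=> [l a x y|x a l l']; rewrite /b -linearP ?pureDr ?pureZr// -pure_linearl.
  by apply: piE; rewrite rK linearP !rK.
have E : (tensor_lift bP \o tensor_map q idfun : {linear _ -> _}) =1 quot_pi im.
  by apply: tensor_ext => x l; rewrite /= tensor_mapE tensor_liftE; apply: piE.
move=> qt0; apply/asboolP.
suff : t \in im by [].
by apply/quot_pi_eq0; rewrite -E /= qt0 linear0.
Qed.

End RightExactness.

(** * Flatness of free modules, through coefficients *)

Section FreeFlat.
Variables (R : comNzRingType) (X : choiceType).

Definition coeff (x : X) : {linear freemod R X -> R^o} :=
  free_lift (fun y => (y == x)%:R : R^o).

Lemma coeff_basis x y : coeff x (basis R y) = (y == x)%:R.
Proof. exact: free_liftE. Qed.

Lemma tensor_coeff_bilinear (N : lmodType R) x :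
  bilinear_map (fun (u : freemod R X) (n : N) => (coeff x u : R) *: n).
Proof.
split=> [n a u v|u a n n'] /=.
- by rewrite linearP /= scalerDl -scalerA.
- by rewrite scalerDr !scalerA mulrC.
Qed.

Definition tensor_coeff (N : lmodType R) x : {linear tensor (freemod R X) N -> N} :=
  tensor_lift (tensor_coeff_bilinear N x).

Lemma tensor_coeff_basis (N : lmodType R) x y (n : N) :
  tensor_coeff N x (pure (basis R y) n) = (y == x)%:R *: n.
Proof. by rewrite [LHS]tensor_liftE coeff_basis. Qed.

Lemma tensor_coeff_map (N N' : lmodType R) (f : {linear N -> N'}) x t :
  tensor_coeff N' x (tensor_map idfun f t) = f (tensor_coeff N x t).
Proof.
have E : (tensor_coeff N' x \o tensor_map idfun f : {linear _ -> _}) =1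
         (f \o tensor_coeff N x : {linear _ -> _}).
  apply: tensor_ext => u n; rewrite /= tensor_mapE.
  by rewrite [LHS]tensor_liftE [in RHS]tensor_liftE linearZ_LR.
exact: E t.
Qed.

(** The expansion is claimed on every duplicate-free list containing D, so that two expansions can
    be added over a common list. *)
Lemma tensor_free_expand (N : lmodType R) (t : tensor (freemod R X) N) :
  exists D : seq X, forall D', uniq D' -> {subset D <= D'} ->
    t = \sum_(x <- D') pure (basis R x) (tensor_coeff N x t).
Proof.
pose P t := exists D : seq X, forall D', uniq D' -> {subset D <= D'} ->
  t = \sum_(x <- D') pure (basis R x) (tensor_coeff N x t).
have P0 : P 0.
  by exists [::] => D' _ _; rewrite big1// => x _; rewrite linear0 pure0r.
have PD u v : P u -> P v -> P (u + v).
  move=> [D uD] [E vE]; exists (D ++ E) => D' uniqD' sD'.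
  have sD : {subset D <= D'} by move=> x xD; rewrite sD'// mem_cat xD.
  have sE : {subset E <= D'} by move=> x xE; rewrite sD'// mem_cat xE orbT.
  rewrite {1}(uD _ uniqD' sD) {1}(vE _ uniqD' sE) -big_split.
  by apply: eq_bigr => x _; rewrite linearD pureDr.
have Pb x n : P (pure (basis R x) n).
  exists [:: x] => D uniqD sD; rewrite (bigD1_seq x)//=; last first.
    by apply: sD; rewrite inE.
  rewrite tensor_coeff_basis eqxx scale1r big1 ?addr0// => y yx.
  by rewrite tensor_coeff_basis eq_sym (negbTE yx) scale0r pure0r.
apply: (@tensor_ind _ _ _ P P0) => u n {}t; apply: (PD).
rewrite (freemod_sum u); elim/big_rec: _ => [|x v _ IH].
  by rewrite pure0l.
by rewrite pureDl; apply: (PD _ _ _ IH); rewrite pureZl -pureZr; exact: Pb.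
Qed.

(** The coefficients of a tensor commute with f and determine the tensor, so injectivity is tested
    in N. *)
Lemma freemod_flat : flat (freemod R X).
Proof.
move=> N N' f fi; apply: raddf_inj => t ft; have [D tD] := tensor_free_expand t.
rewrite (tD (undup D)) ?undup_uniq//; last by move=> x; rewrite mem_undup.
rewrite big1// => x _; suff -> : tensor_coeff N x t = 0 by exact: pure0r.
by apply: fi; rewrite -tensor_coeff_map ft !linear0.
Qed.

End FreeFlat.

(** * Retractions given by field idempotents *)

Section Retraction.
Variable R : comNzRingType.

(* The ideal generated by such an element is 0 or a field with unit e. *)
Definition field_idempotent (e : R) :=
  e * e = e /\ forall a, a * e = 0 \/ exists b, b * (a * e) = e.

Variables (N N' : lmodType R) (f : {linear N -> N'}) (e : R).
Hypotheses (f_inj : injective f) (eP : field_idempotent e).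

Let independent (S : set N') :=
  (forall a x y, S x -> S y -> S (a *: x + y)) /\
  (forall n, S (e *: f n) -> e *: f n = 0).

(* A maximal submodule S of N' independent of e f(N) satisfies
   e N' <= S + e f(N): the coefficients a e are zero or invertible. *)
Lemma idempotent_complement : exists S : set N', [/\ S 0, independent S &
  forall y, exists s n, S s /\ e *: y = s + e *: f n].
Proof.
have [|S [[SL S0] Smax]] := @Zorn_bigcup N' independent.
  move=> F Fi Ft; split.
    move=> a x y [A FA Ax] [B FB By].
    have [AB|BA] := Ft _ _ FA FB.
    - by exists B => //; apply: (Fi _ FB).1 => //; exact: AB.
    - by exists A => //; apply: (Fi _ FA).1 => //; exact: BA.
  by move=> n [A FA An]; exact: (Fi _ FA).2.
(* [independent] does not ask for 0, so that the union of the empty chain qualifies. A maximal S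
   without 0 would be empty, since x in S gives (-1) x + x = 0, and {0} would then be larger. *)
have Sz : S 0.
  apply: contrapT => nS0.
  have SE x : ~ S x.
    move=> Sx; apply: nS0; suff -> : 0 = (-1) *: x + x by exact: SL.
    by rewrite scaleN1r addNr.
  apply: (Smax [set 0]%classic).
    by split=> [x /SE//|/(_ 0 erefl)].
  split=> [a x y -> ->|n ->//].
  by rewrite scaler0 addr0.
exists S; split=> // y.
(* The submodule generated by S and e y. Either it is S, and e y lies in S, or maximality makes it
   meet e f(N) outside 0. *)
pose T : set N' := [set z | exists a s, S s /\ z = s + a *: (e *: y)]%classic.
have SZ a s : S s -> S (a *: s) by move=> Ss; rewrite -[a *: s]addr0; exact: SL.
have ST : (S `<=` T)%classic.
  by move=> s Ss; exists 0, s; split=> //; rewrite scale0r addr0.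
have Ty : T (e *: y) by exists 1, 0; split=> //; rewrite scale1r add0r.
have [TS|nTS] := pselect (T `<=` S)%classic.
  exists (e *: y), 0; split; first exact: TS.
  by rewrite linear0 scaler0 addr0.
have : ~ independent T by apply: Smax; split.
move=> /not_andP[nL|]; first case: nL.
  move=> a _ _ [b [s [Ss ->]]] [c [u [Su ->]]].
  exists (a * b + c), (a *: s + u); split; first exact: SL.
  by rewrite scalerDr scalerDl -scalerA addrACA.
move=> /existsNP[n] /not_implyP[[a [s [Ss nE]]]] n0.
(* The nonzero element is e f(n) = s + a e y. If a e = 0 it lies in S, against independence;
   otherwise multiplying by b with b a e = e solves for e y. *)
have [ae0|[b bE]] := eP.2 a.
  case: n0; apply: S0; rewrite nE scalerA ae0 scale0r addr0.
  exact: Ss.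
exists (- b *: s), (b *: n); split; first exact: SZ.
rewrite linearZ_LR scalerA [e * b]mulrC -scalerA nE scalerDr addrA scaleNr.
rewrite addNr add0r.
by rewrite !scalerA -!mulrA bE.
Qed.

(** The relation e y = s + e f(n) with s in S and the normalization e n = n determines n from y, by
    independence of S and injectivity of f. Its graph is a submodule, so y |-> n is linear; y = f x
    has s = 0 and n = e x. *)
Lemma idempotent_retraction :
  exists g : {linear N' -> N}, forall x, g (f x) = e *: x.
Proof.
have [S [Sz [SL S0] Sc]] := idempotent_complement.
pose G y n := exists s, [/\ S s, e *: y = s + e *: f n & e *: n = n].
have Gex y : exists n, G y n.
  have [s [n [Ss yE]]] := Sc y; exists (e *: n), s; split=> //.
  - by rewrite linearZ_LR scalerA eP.1.
  - by rewrite scalerA eP.1.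
have Guniq y n n' : G y n -> G y n' -> n = n'.
  move=> [s [Ss yE en]] [s' [Ss' yE' en']]; rewrite -en -en'.
  apply: f_inj; rewrite !linearZ_LR; apply/eqP.
  rewrite -subr_eq0 -scalerBr -linearB; apply/eqP/S0.
  suff -> : e *: f (n - n') = (-1) *: s + s' by exact: SL.
  have fE u k : e *: y = u + e *: f k -> e *: f k = e *: y - u.
    by move=> ->; rewrite addrAC subrr add0r.
  rewrite linearB scalerBr scaleN1r (fE _ _ yE) (fE _ _ yE').
  by rewrite opprB addrC addrA subrK addrC.
pose g y := sval (cid (Gex y)).
have gP y : G y (g y) := svalP (cid (Gex y)).
have gl : linear g.
  move=> a x y; apply: (Guniq (a *: x + y)) => //.
  have [[s [Ss xE en]] [s' [Ss' yE en']]] := (gP x, gP y).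
  exists (a *: s + s'); split; first exact: SL.
    rewrite (linearP f) !scalerDr !scalerA ![e * a]mulrC -!scalerA xE yE.
    by rewrite scalerDr addrACA.
  by rewrite scalerDr scalerA [e * a]mulrC -scalerA en en'.
pose gm := GRing.isLinear.Build R N' N *:%R g gl.
exists (HB.pack g gm : {linear N' -> N}) => x /=.
apply: (Guniq (f x)) => //; exists 0; split=> //.
- by rewrite add0r linearZ_LR scalerA eP.1.
- by rewrite scalerA eP.1.
Qed.

End Retraction.

(** Tensoring the partial retraction g with L factors multiplication by e through f ⊗ L. *)
Lemma field_idempotent_ker (R : comNzRingType) (N N' L : lmodType R)
    (f : {linear N -> N'}) (e : R) (t : tensor N L) :
  injective f -> field_idempotent e -> tensor_map f idfun t = 0 -> e *: t = 0.
Proof.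
move=> fi eP ft; have [g gf] := idempotent_retraction fi eP.
have E : (tensor_map g idfun \o tensor_map f idfun : {linear _ -> _}) =1
         (e \*: idfun : {linear tensor N L -> _}).
  by apply: tensor_ext => x l; rewrite /= !tensor_mapE gf pureZl.
by have := E t; rewrite /= ft linear0.
Qed.

(** * Base change along a quotient split by idempotents *)

Section SplitQuotient.
Variables (R A : comNzRingType) (pi : {rmorphism R -> A}).

(** When J = ker pi has local units this is the submodule JM, the kernel of M -> M/JM. A single
    multiplier fixing x makes it pull back along injections as well as push forward. *)
Definition Jtorsion (M : lmodType R) (x : M) := exists r, pi r = 0 /\ r *: x = x.

Variable s : {rmorphism A -> R}.

(* What the theorem uses of T(A): the section s is the diagonal embedding, and
   J = ker pi is the direct sum of copies of the residue field. *)
Definition split_by_idempotents :=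
  [/\ forall a, pi (s a) = a,
      forall r, pi r = 0 -> exists e, pi e = 0 /\ e * r = r &
      forall r, pi r = 0 -> exists l : seq R,
        (forall d, d \in l -> field_idempotent d) /\ r = \sum_(d <- l) r * d].
Hypothesis piP : split_by_idempotents.

Let sK : forall a, pi (s a) = a.
Proof. by case: piP. Qed.

Lemma Jtorsion0 (M : lmodType R) : Jtorsion (0 : M).
Proof. by exists 0; rewrite rmorph0 scaler0. Qed.

(** The multiplier comes from 1 - (a + b - a b) = (1 - a)(1 - b), which kills both x and y. *)
Lemma JtorsionD (M : lmodType R) (x y : M) :
  Jtorsion x -> Jtorsion y -> Jtorsion (x + y).
Proof.
move=> [a [a0 ax]] [b [b0 bx]]; exists (a + b - a * b); split.
  by rewrite rmorphB rmorphD rmorphM a0 b0 mulr0 addr0 subr0.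
rewrite scalerDr !scalerBl !scalerDl; congr (_ + _).
  by rewrite mulrC -scalerA ax addrK.
by rewrite -scalerA bx addrAC subrr add0r.
Qed.

Lemma Jtorsion_map (M N : lmodType R) (f : {linear M -> N}) x :
  Jtorsion x -> Jtorsion (f x).
Proof. by move=> [r [r0 rx]]; exists r; rewrite -linearZ_LR rx. Qed.

Lemma Jtorsion_inj (M N : lmodType R) (f : {linear M -> N}) x :
  injective f -> Jtorsion (f x) -> Jtorsion x.
Proof.
by move=> fi [r [r0 rx]]; exists r; split=> //; apply: fi; rewrite linearZ_LR.
Qed.

Lemma Jtorsion_scale (M : lmodType R) r (x : M) : pi r = 0 -> Jtorsion (r *: x).
Proof.
case: piP => _ local_units _ /local_units[e [e0 er]].
by exists e; rewrite scalerA er.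
Qed.

Lemma Jtorsion_restr (Q : lmodType A) (x : restr_scalars pi Q) :
  Jtorsion x -> x = 0.
Proof.
move=> [r [r0 <-]]; rewrite -[LHS]/(pi r *: (x : Q)) r0; exact: (scale0r (x : Q)).
Qed.

(** By right exactness the kernel is generated by the k ⊗ l with k in ker q, and a multiplier fixing
    k fixes k ⊗ l. *)
Lemma Jtorsion_tensor_ker (M M' L : lmodType R) (q : {linear M -> M'}) t :
  (forall y, exists x, q x = y) -> (forall x, q x = 0 -> Jtorsion x) ->
  tensor_map q (idfun : {linear L -> L}) t = 0 -> Jtorsion t.
Proof.
move=> qs qk qt; have [|u <-] := tensor_right_exact (i := ker_incl q) qs _ qt.
  by move=> x qx; exists (ker_elt qx); rewrite ker_eltK.
elim/tensor_ind: u => [|k l u IH]; first by rewrite linear0; exact: Jtorsion0.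
rewrite linearD tensor_mapE; apply: JtorsionD IH.
have [r [r0 rk]] := qk _ (ker_inclE k).
by exists r; rewrite -pureZl rk.
Qed.

(** Some r in J fixes t, yet r is a sum of multiples of field idempotents, each of which kills the
    kernel of f ⊗ L. *)
Lemma Jtorsion_tensor_inj (N N' L : lmodType R) (f : {linear N -> N'}) t :
  injective f -> tensor_map f (idfun : {linear L -> L}) t = 0 ->
  Jtorsion t -> t = 0.
Proof.
move=> fi ft [r [r0 <-]]; case: piP => _ _ /(_ r r0)[l [lP ->]].
rewrite scaler_suml big_seq big1// => d dl.
by rewrite -scalerA (field_idempotent_ker fi (lP _ dl) ft) scaler0.
Qed.

Section Ext.
Variable M : lmodType R.
Local Notation MA := (ext_scalars pi M).

(** The map x |-> 1 ⊗ x, which plays the role of the projection M -> M/JM. *)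
Definition ext_unit_fun (x : M) : restr_scalars pi MA :=
  (pure (1 : phi_ring pi) x : tensor (phi_ring pi) M).

Lemma ext_scale_section a (t : tensor (phi_ring pi) M) :
  a *: (t : MA) = (s a *: t : tensor (phi_ring pi) M).
Proof.
have E : tensor_map (mul_by pi a) idfun =1
         (s a \*: idfun : {linear tensor (phi_ring pi) M -> _}).
  apply: tensor_ext => b x; rewrite /= tensor_mapE -pureZl.
  apply: (congr1 (fun c => pure c x)).
  by rewrite -[RHS]/(pi (s a) * (b : A)) sK.
exact: E t.
Qed.

Lemma ext_scale_restr r (t : tensor (phi_ring pi) M) :
  pi r *: (t : MA) = (r *: t : tensor (phi_ring pi) M).
Proof.
have E : tensor_map (mul_by pi (pi r)) idfun =1
         (r \*: idfun : {linear tensor (phi_ring pi) M -> _}).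
  by apply: tensor_ext => b x; rewrite /= tensor_mapE -pureZl.
exact: E t.
Qed.

Lemma ext_unit_linear : linear ext_unit_fun.
Proof.
move=> r x y; rewrite /ext_unit_fun pureDr pureZr.
by congr (_ + _); apply: esym; exact: (ext_scale_restr r (pure _ _)).
Qed.
HB.instance Definition _ := GRing.isLinear.Build R M (restr_scalars pi MA) *:%R
  ext_unit_fun ext_unit_linear.
Definition ext_unit : {linear M -> restr_scalars pi MA} := ext_unit_fun.

Lemma ext_unitE x : ext_unit x = (pure (1 : phi_ring pi) x : tensor (phi_ring pi) M).
Proof. by []. Qed.

Lemma ext_unit_surj (t : MA) : exists x, ext_unit x = t.
Proof.
move: t.
apply: (@tensor_ind _ (phi_ring pi) M (fun t => exists x, ext_unit x = t)).
  by exists 0; rewrite linear0.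
move=> a x t [y <-]; exists (s a *: x + y); apply: etrans (linearD _ _ _) _.
apply: (congr1 (+%R^~ (ext_unit y))); rewrite ext_unitE pureZr -pureZl.
apply: (congr1 (fun c => pure c x)).
by rewrite -[LHS]/(pi (s a) * 1) sK mulr1.
Qed.

Lemma ext_unit_torsion x : Jtorsion x -> ext_unit x = 0.
Proof. by move=> /(Jtorsion_map ext_unit)/Jtorsion_restr. Qed.

Let pi_lin_fun (r : R^o) : phi_ring pi := pi r.
Let pi_lin_linear : linear pi_lin_fun.
Proof. by move=> r x y; rewrite /pi_lin_fun rmorphD rmorphM. Qed.
HB.instance Definition _ :=
  GRing.isLinear.Build R R^o (phi_ring pi) *:%R pi_lin_fun pi_lin_linear.

Let regular_bilinear : bilinear_map (fun (r : R^o) (x : M) => (r : R) *: x).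
Proof.
split=> [x a r r'|r a x x'] /=; first by rewrite scalerDl -scalerA.
by rewrite scalerDr !scalerA mulrC.
Qed.

(** The action map R ⊗ M -> M sends 1 ⊗ x to x, and the hypothesis puts 1 ⊗ x in the kernel of pi ⊗
    M. The kernel of pi : R -> A consists of elements fixed by some element of J, thanks to local
    units. *)
Lemma ext_unit_ker x : ext_unit x = 0 -> Jtorsion x.
Proof.
move=> x0; rewrite -[x]scale1r -(tensor_liftE regular_bilinear).
apply: Jtorsion_map; apply: (Jtorsion_tensor_ker (q := pi_lin_fun)).
- by move=> a; exists (s a); exact: sK.
- move=> r r0; case: piP => _ /(_ r r0)[e [e0 er]] _; exists e; split=> //.
- rewrite tensor_mapE -[RHS]x0; apply: (congr1 (fun c => pure c x)).
  exact: rmorph1.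
Qed.

Section Lift.
Variables (Q : lmodType A) (q : {linear M -> restr_scalars pi Q}).

Let b (a : phi_ring pi) (x : M) : restr_scalars pi Q := (a : A) *: (q x : Q).
Let bP : bilinear_map b.
Proof.
split=> [x r a a'|a r x x']; rewrite /b.
  by rewrite scalerDl; congr (_ + _); apply: esym; exact: (scalerA (pi r)).
rewrite (linearP q).
apply: (etrans (scalerDr (a : A) (pi r *: (q x : Q)) (q x' : Q))).
apply: (congr1 (fun z : Q => z + (a : A) *: (q x' : Q))).
by rewrite scalerA mulrC -scalerA.
Qed.

Definition ext_lift_fun (t : MA) : Q := tensor_lift bP t.
Lemma ext_lift_linear : linear ext_lift_fun.
Proof.
move=> a t u; rewrite ext_scale_section /ext_lift_fun linearP; congr (_ + _).
by rewrite -[LHS]/(pi (s a) *: (tensor_lift bP t : Q)) sK.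
Qed.
HB.instance Definition _ := GRing.isLinear.Build A MA Q *:%R
  ext_lift_fun ext_lift_linear.
Definition ext_lift : {linear MA -> Q} := ext_lift_fun.

Lemma ext_lift_unit x : ext_lift (ext_unit x) = q x.
Proof. by rewrite -[LHS]/(tensor_lift bP _) tensor_liftE /b; exact: scale1r. Qed.

(** This recognizes Q as M/JM: the inclusion of JM in ker q is automatic because J kills Q, and the
    second hypothesis is the converse. *)
Lemma ext_lift_bij : (forall y, exists x, q x = y) ->
  (forall x, q x = 0 -> Jtorsion x) -> bijective ext_lift.
Proof.
move=> qs qk; apply: inj_surj_bij.
  apply: raddf_inj => t; have [x <-] := ext_unit_surj t.
  move=> qx0; apply/ext_unit_torsion/qk.
  exact: etrans (esym (ext_lift_unit x)) qx0.
by move=> y; have [x <-] := qs y; exists (ext_unit x); exact: ext_lift_unit.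
Qed.

End Lift.
End Ext.

End SplitQuotient.

(** * Tensor products over A computed over R, and transfer of flatness *)

Section TensorRestriction.
Variables (R A : comNzRingType) (pi : {rmorphism R -> A}) (s : {rmorphism A -> R}).
Hypothesis piP : split_by_idempotents pi s.

Let sK : forall a, pi (s a) = a.
Proof. by case: piP. Qed.

Lemma ext_map_unit (M N : lmodType R) (f : {linear M -> N}) x :
  ext_map pi f (ext_unit pi M x) = ext_unit pi N (f x).
Proof. exact: tensor_mapE. Qed.

(** This is flatness of A over R: if r (f x) = f x with r in J, then r x = x already. *)
Lemma ext_map_inj (M N : lmodType R) (f : {linear M -> N}) :
  injective f -> injective (ext_map pi f).
Proof.
move=> fi; apply: raddf_inj => t; have [x <-] := ext_unit_surj piP t.
move=> fx; apply: (ext_unit_torsion); apply: (Jtorsion_inj fi).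
by apply: (ext_unit_ker piP); rewrite -[RHS]fx -ext_map_unit.
Qed.

Section Comparison.
Variables (Q : lmodType A) (N : lmodType R).
Local Notation QR := (restr_scalars pi Q).
Local Notation NA := (ext_scalars pi N).

Let b (x : QR) (n : N) : restr_scalars pi (tensor Q NA) :=
  pure (x : Q) (ext_unit pi N n : NA).
Let bP : bilinear_map b.
Proof.
split=> [n r x y|x r n n']; rewrite /b.
  exact: (pure_linearl (ext_unit pi N n : NA) (pi r)).
rewrite linearP; exact: (pure_linearr (x : Q) (pi r)).
Qed.

Definition restr_tensor : {linear tensor QR N -> restr_scalars pi (tensor Q NA)} :=
  tensor_lift bP.

Lemma restr_tensorE (x : QR) (n : N) :
  restr_tensor (pure x n) = pure (x : Q) (ext_unit pi N n : NA).
Proof. exact: tensor_liftE. Qed.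

Local Notation T := (tensor QR N).

(** For fixed x, the map n |-> x ⊗ n must extend to ext N, so its target needs an A-action, which s
    provides. Acting by s (pi r) is the same as acting by r, because the factor Q only sees pi r. *)
Let c_fun (x : Q) (n : N) : restr_scalars pi (restr_scalars s T) :=
  pure (x : QR) n.
Let c_linear x : linear (c_fun x).
Proof.
move=> r n n'; rewrite /c_fun pureDr.
apply: (congr1 (fun z : T => z + pure (x : QR) n')).
rewrite pureZr -[RHS]/(s (pi r) *: pure (x : QR) n) -!pureZl.
apply: (congr1 (fun z : QR => pure z n)).
by rewrite -[RHS]/(pi (s (pi r)) *: x) sK.
Qed.
HB.instance Definition _ x :=
  GRing.isLinear.Build R N (restr_scalars pi (restr_scalars s T)) *:%R
    (c_fun x) (c_linear x).

Let d (x : Q) (y : NA) : restr_scalars s T := ext_lift piP (c_fun x) y.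
Let dE x n : d x (ext_unit pi N n) = pure (x : QR) n.
Proof. exact: ext_lift_unit. Qed.
Let dP : bilinear_map d.
Proof.
split=> [y a x x'|x a y y']; last by rewrite /d linearP.
have [n <-] := ext_unit_surj piP y; rewrite !dE.
have ax : s a *: (x : QR) = a *: x :> Q by exact: (congr1 (fun c => c *: x) (sK a)).
apply: etrans (congr1 (fun z : QR => pure (z + (x' : QR)) n) (esym ax)) _.
exact: (pure_linearl n (s a)).
Qed.

Lemma restr_tensor_inj : injective restr_tensor.
Proof.
pose g : {linear tensor Q NA -> restr_scalars s T} := tensor_lift dP.
apply: (can_inj (g := (g : tensor Q NA -> T))).
apply: tensor_ind => [|x n t IH]; first by rewrite linear0; exact: (linear0 g).
rewrite linearD; apply: etrans (linearD g _ _) _.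
apply: etrans (congr1 (fun z : T => g (restr_tensor (pure x n)) + z : T) IH) _.
apply: (congr1 (fun z : T => z + t)); rewrite restr_tensorE.
exact: etrans (tensor_liftE _ _ _) (dE _ _).
Qed.

Lemma restr_tensor_surj (t : tensor Q NA) : exists u, restr_tensor u = t.
Proof.
move: t; apply: tensor_ind => [|x y t [u <-]]; first by exists 0; exact: linear0.
have [n <-] := ext_unit_surj piP y; exists (pure (x : QR) n + u).
by rewrite linearD restr_tensorE.
Qed.

End Comparison.

Lemma restr_tensor_mapl (Q Q' : lmodType A) (N : lmodType R)
    (h : {linear Q -> Q'}) (t : tensor (restr_scalars pi Q) N) :
  restr_tensor Q' N (tensor_map (restr_map pi h) idfun t) =
  tensor_map h idfun (restr_tensor Q N t).
Proof.
have E : (restr_tensor Q' N \o tensor_map (restr_map pi h) idfun : {linear _ -> _}) =1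
   (restr_map pi (tensor_map h idfun) \o restr_tensor Q N : {linear _ -> _}).
  apply: tensor_ext => x n; rewrite /= tensor_mapE !restr_tensorE.
  by apply: esym; exact: tensor_mapE.
exact: E t.
Qed.

Lemma restr_tensor_mapr (Q : lmodType A) (N N' : lmodType R)
    (f : {linear N -> N'}) (t : tensor (restr_scalars pi Q) N) :
  restr_tensor Q N' (tensor_map idfun f t) =
  tensor_map idfun (ext_map pi f) (restr_tensor Q N t).
Proof.
have E : (restr_tensor Q N' \o tensor_map idfun f : {linear _ -> _}) =1
   (restr_map pi (tensor_map idfun (ext_map pi f)) \o restr_tensor Q N
     : {linear _ -> _}).
  apply: tensor_ext => x n; rewrite /= tensor_mapE !restr_tensorE.
  apply: esym; apply: etrans (tensor_mapE _ _ _ _) _.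
  by rewrite ext_map_unit.
exact: E t.
Qed.

Lemma flat_restr (Q : lmodType A) : flat Q -> flat (restr_scalars pi Q).
Proof.
move=> Qf N N' f fi t u tu; apply: restr_tensor_inj.
apply: (Qf _ _ _ (ext_map_inj fi)).
apply: etrans (esym (restr_tensor_mapr f t)) _; rewrite tu.
exact: restr_tensor_mapr.
Qed.

Lemma flat_ext (M : lmodType R) : flat M -> flat (ext_scalars pi M).
Proof.
move=> Mf; apply: flat_of_right => N N' f fi t u.
have [[v <-] [w <-]] := (restr_tensor_surj t, restr_tensor_surj u).
move=> fvw; apply: (congr1 (restr_tensor N M)).
apply: (flat_right Mf (f := restr_map pi f) fi); apply: restr_tensor_inj.
apply: etrans (restr_tensor_mapl f v) _.
exact: etrans fvw (esym (restr_tensor_mapl f w)).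
Qed.

(** An element t of ker (f ⊗ M) dies in ext N ⊗ M, since ext f is injective and ext M is flat over
    A. So t is fixed by an element of J, and being in the kernel it vanishes. *)
Lemma flat_of_ext (M : lmodType R) : flat (ext_scalars pi M) -> flat M.
Proof.
move=> Mf; apply: flat_of_right => N N' f fi; apply: raddf_inj => t ft.
apply: (Jtorsion_tensor_inj piP fi ft).
apply: (Jtorsion_tensor_ker (q := ext_unit pi N) (fun y => ext_unit_surj piP y)
  (fun x => ext_unit_ker piP (x := x))).
apply: restr_tensor_inj; rewrite linear0.
apply: (flat_right Mf (ext_map_inj fi)); rewrite linear0 -restr_tensor_mapl.
have E : (tensor_map (restr_map pi (ext_map pi f)) idfun \o
          tensor_map (ext_unit pi N) idfun : {linear tensor N M -> _}) =1
   (tensor_map (ext_unit pi N') idfun \o tensor_map f idfun : {linear _ -> _}).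
  by apply: tensor_ext => x l; rewrite /= !tensor_mapE.
apply: etrans (congr1 (restr_tensor _ _) (E t)) _.
by rewrite /= ft !linear0.
Qed.

End TensorRestriction.

(** * Flat dimension *)

Lemma bijective_linear_inv (R : pzRingType) (V W : lmodType R) (h : {linear V -> W}) :
  bijective h -> exists g : {linear W -> V}, cancel h g /\ cancel g h.
Proof.
move=> [g hK gK].
pose gm := GRing.isLinear.Build R W V *:%R g (can2_linear hK gK).
by exists (HB.pack g gm : {linear W -> V}).
Qed.

Lemma flat_iso (R : comNzRingType) (M M' : lmodType R) (h : {linear M -> M'}) :
  bijective h -> flat M -> flat M'.
Proof.
move=> /bijective_linear_inv[g [hK gK]] Mf N N' f fi.
have E t : tensor_map g idfun (tensor_map idfun f t) =
           tensor_map idfun f (tensor_map g idfun t).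
  apply: etrans (tensor_map_comp _ _ _ _ _) _; apply: esym.
  by apply: etrans (tensor_map_comp _ _ _ _ _) _; exact: eq_tensor_map.
have gN : injective (tensor_map g (idfun : {linear N -> N})).
  apply: (can_inj (g := tensor_map h idfun)) => t.
  apply: etrans (tensor_map_comp _ _ _ _ _) _; apply: etrans (tensor_map_id t).
  by apply: eq_tensor_map => // x; exact: gK.
move=> t u tu; apply: gN; apply: (Mf _ _ _ fi).
by apply: etrans (esym (E t)) _; rewrite tu; exact: E.
Qed.

Section KernelLift.
Variables (R : pzRingType) (U V W : lmodType R).
Variables (f : {linear V -> W}) (h : {linear U -> V}).

Definition maps_into_kernel := forall x, f (h x) = 0.
Hypothesis fh0 : maps_into_kernel.

Definition ker_lift_fun of maps_into_kernel : U -> kermod f :=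
  fun x => ker_elt (fh0 x).
Lemma ker_lift_linear : linear (ker_lift_fun fh0).
Proof.
by move=> a x y; apply: ker_incl_inj; rewrite linearP !ker_eltK linearP.
Qed.
HB.instance Definition _ :=
  GRing.isLinear.Build R _ _ *:%R (ker_lift_fun fh0) ker_lift_linear.
Definition ker_lift : {linear U -> kermod f} := ker_lift_fun fh0.

Lemma ker_liftE x : ker_incl f (ker_lift x) = h x.
Proof. exact: ker_eltK. Qed.

End KernelLift.

Section FlatDimensionBound.
Variable R : comNzRingType.
Implicit Types M : lmodType R.

(** Resolutions unfolded one short exact sequence at a time, so that base change and pullback act on
    one flat cover per induction step. *)
Fixpoint fd_le n M : Prop :=
  if n is n'.+1 then
    exists (K F : lmodType R) (i : {linear K -> F}) (e : {linear F -> M}),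
      [/\ flat F, injective i, forall y, exists x, e x = y,
          forall x, e x = 0 <-> exists k, i k = x & fd_le n' K]
  else flat M.

Lemma fd_le_iso n M M' (h : {linear M -> M'}) :
  bijective h -> fd_le n M -> fd_le n M'.
Proof.
case: n => [|n] hb; first exact: (flat_iso hb).
move=> [K [F [i [e [Ff ii es ek Kn]]]]].
exists K, F, i, (h \o e); split=> // [y|x].
  have [x <-] := bij_surj hb y; have [z <-] := es x; by exists z.
rewrite -ek /=; split=> [hex|->]; last exact: linear0.
by apply: (bij_inj hb); rewrite linear0.
Qed.

Lemma flat_zero M : (forall x : M, x = 0) -> flat M.
Proof.
move=> M0 N N' f fi; apply: raddf_inj => t _.
move: t; apply: (@tensor_ind _ _ _ (fun t => t = 0)) => // x y t ->.
by rewrite (M0 x) pure0l addr0.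
Qed.

Lemma fd_leP n M : flat_resolution_of_length M n <-> fd_le n M.
Proof.
elim: n M => [|n IH] M; split.
- move=> [F [e [d [Ff F0 es ek dk]]]].
  apply: (flat_iso (h := e)) => //; apply: inj_surj_bij => //.
  apply: raddf_inj => x /ek[y <-].
  by rewrite (F0 1%N isT y) linear0.
(* Z is a zero module, realized as the kernel of the identity; it fills the positive degrees. *)
- move=> Mf; pose Z : lmodType R := kermod (idfun : {linear M -> M}).
  have Z0 (z : Z) : z = 0.
    by apply: ker_incl_inj; rewrite linear0; exact: (ker_inclE z).
  exists (fun i => if i is 0 then M else Z), idfun, (fun=> \0); split.
  + by move=> [|i]; [exact: Mf|exact: flat_zero].
  + by move=> [|i]// _ x; exact: Z0.
  + by move=> y; exists y.
  + move=> x; split=> [x0|[y <-//]]; exists 0; exact: esym.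
  + by move=> i x; split=> // _; exists 0; rewrite [x]Z0.
- move=> [F [e [d [Ff F0 es ek dk]]]].
  have ed0 : maps_into_kernel e (d 0%N) by move=> x; apply/ek; exists x.
  exists (kermod e), (F 0%N), (ker_incl e), e.
  split; [exact: Ff|exact: ker_incl_inj|exact: es| |].
  + move=> x; split=> [ex|[k <-]]; last exact: ker_inclE.
    by exists (ker_elt ex); exact: ker_eltK.
  (* The resolution shifted by one resolves ker e, with d 0 corestricted as augmentation. *)
  apply/IH; exists (fun i => F i.+1), (ker_lift ed0), (fun i => d i.+1).
  split; [by move=> i; exact: Ff| | | |by move=> i; exact: dk].
  + by move=> i ni; exact: F0.
  + move=> y; have /ek[x xy] := ker_inclE y; exists x.
    by apply: ker_incl_inj; rewrite ker_liftE.
  + move=> x; rewrite -dk; split=> [x0|dx0].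
      by rewrite -(ker_liftE ed0) x0 linear0.
    by apply: ker_incl_inj; rewrite ker_liftE linear0.
(* Splicing: F goes in front of the resolution G of K, and the new first differential is i composed
   with the augmentation a. *)
- move=> [K [F [i [e [Ff ii es ek /IH[G [a [d [Gf G0 as_ ak dk]]]]]]]]].
  exists (fun j => match j return lmodType R with 0 => F | j'.+1 => G j' end), e.
  exists (fun j => match j return {linear G j ->
     (match j return lmodType R with 0 => F | j'.+1 => G j' end)}
    with 0 => i \o a | j'.+1 => d j' end).
  split; [ | |exact: es| |].
  + by move=> [|j]; [exact: Ff|exact: Gf].
  + by move=> [|j]// jn x; exact: G0.
  + move=> x; rewrite ek; split=> [[k <-]|[y <-]]; last by exists (a y).
    by have [y <-] := as_ k; exists y.
  + case=> [|j] x; last exact: dk.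
    rewrite -ak /=; split=> [iax|->]; last exact: linear0.
    by apply: ii; rewrite linear0.
Qed.

End FlatDimensionBound.

Lemma eq_fd (R S : comNzRingType) (M : lmodType R) (N : lmodType S) :
  (forall n, fd_le n M <-> fd_le n N) -> fd M = fd N.
Proof.
move=> MN; apply: (congr1 least); apply/funext => n; apply/propext.
by split=> [/fd_leP/MN/fd_leP|/fd_leP/MN/fd_leP].
Qed.

Section FlatDimensionTransfer.
Variables (R A : comNzRingType) (pi : {rmorphism R -> A}) (s : {rmorphism A -> R}).
Hypothesis piP : split_by_idempotents pi s.

Lemma fd_le_ext n (M : lmodType R) : fd_le n M -> fd_le n (ext_scalars pi M).
Proof.
elim: n M => [|n IH] M; first exact: (flat_ext piP).
move=> [K [F [i [e [Ff ii es ek Kn]]]]].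
exists (ext_scalars pi K), (ext_scalars pi F), (ext_map pi i), (ext_map pi e).
split; [exact: (flat_ext piP)|exact: (ext_map_inj piP)| | |exact: IH].
- move=> y; have [x <-] := ext_unit_surj piP y; have [z <-] := es x.
  by exists (ext_unit pi F z); exact: ext_map_unit.
- move=> x; split=> [|[k <-]].
    have [z <-] := ext_unit_surj piP x; rewrite ext_map_unit.
    move=> /(ext_unit_ker piP)[r [r0 rz]].
    (* A lift z of a cycle satisfies e z = r (e z) with r in J. Replacing z by z - r z gives a true
       element of ker e with the same image in ext F. *)
    have /ek[k kE] : e (z - r *: z) = 0 by rewrite linearB linearZ_LR rz subrr.
    exists (ext_unit pi K k); rewrite ext_map_unit kE linearB.
    by rewrite (ext_unit_torsion (Jtorsion_scale piP z r0)) subr0.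
  have [z <-] := ext_unit_surj piP k; rewrite !ext_map_unit.
  have /ek -> : exists k, i k = i z by exists z.
  exact: linear0.
Qed.

Definition restr_counit (Q : lmodType A) :
    {linear ext_scalars pi (restr_scalars pi Q) -> Q} :=
  ext_lift piP (idfun : {linear restr_scalars pi Q -> restr_scalars pi Q}).

Lemma restr_counit_bij (Q : lmodType A) : bijective (restr_counit Q).
Proof.
apply: ext_lift_bij => [y|x /= ->]; first by exists y.
exact: Jtorsion0.
Qed.

(** * The fibre product of M and a cover of ext M *)

Section Pullback.
Variables (M : lmodType R) (Q : lmodType A).
Variable e : {linear Q -> ext_scalars pi M}.
Hypothesis e_surj : forall y, exists x, e x = y.

Local Notation QR := (restr_scalars pi Q).

Let h_fun (z : M * QR) : restr_scalars pi (ext_scalars pi M) :=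
  ext_unit pi M z.1 - restr_map pi e z.2.
Let h_linear : linear h_fun.
Proof.
move=> r x y; apply: etrans (f_equal2 (fun u v => u - v)
  (linearP (ext_unit pi M) r x.1 y.1) (linearP (restr_map pi e) r x.2 y.2)) _.
have E (V : lmodType R) (a b c d : V) :
    (r *: a + b) - (r *: c + d) = r *: (a - c) + (b - d).
  by rewrite opprD addrACA scalerBr.
exact: E.
Qed.
HB.instance Definition _ := GRing.isLinear.Build R (M * QR)%type
  (restr_scalars pi (ext_scalars pi M)) *:%R h_fun h_linear.

Definition pullback : lmodType R := kermod (h_fun : {linear (M * QR)%type -> _}).

Let p1_fun (x : pullback) : M := (ker_incl h_fun x).1.
Let p1_linear : linear p1_fun.
Proof. by move=> r x y; rewrite /p1_fun linearP. Qed.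
HB.instance Definition _ := GRing.isLinear.Build R pullback M *:%R p1_fun p1_linear.
Definition pullback_fst : {linear pullback -> M} := p1_fun.

Let p2_fun (x : pullback) : QR := (ker_incl h_fun x).2.
Let p2_linear : linear p2_fun.
Proof. by move=> r x y; rewrite /p2_fun linearP. Qed.
HB.instance Definition _ := GRing.isLinear.Build R pullback QR *:%R p2_fun p2_linear.
Definition pullback_snd : {linear pullback -> QR} := p2_fun.

Lemma pullback_eq x y : pullback_fst x = pullback_fst y ->
  pullback_snd x = pullback_snd y -> x = y.
Proof.
move=> e1 e2; apply: ker_incl_inj.
by rewrite [LHS]surjective_pairing [RHS]surjective_pairing; congr (_, _).
Qed.

Lemma pullbackP x : e (pullback_snd x) = ext_unit pi M (pullback_fst x).
Proof.
by have /eqP := ker_inclE x; rewrite subr_eq0 => /eqP.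
Qed.

Lemma pullback_ex x (y : Q) : e y = ext_unit pi M x ->
  exists z, pullback_fst z = x /\ pullback_snd z = y.
Proof.
move=> ey; have h0 : h_fun (x, y : QR) = 0.
  by apply/eqP; rewrite /h_fun subr_eq0; apply/eqP; exact: esym.
by exists (ker_elt h0); rewrite /= /p1_fun /p2_fun ker_eltK.
Qed.

(** The projection to Q inherits surjectivity from M -> ext M. An element of its kernel has the form
    (x, 0) with x in the kernel of M -> ext M, so it is fixed by an element of J. *)
Lemma pullback_ext_bij : bijective (ext_lift piP pullback_snd).
Proof.
apply: ext_lift_bij => [y|z z0].
  have [x xE] := ext_unit_surj piP (e y).
  by have [z [_ <-]] := pullback_ex (esym xE); exists z.
have : ext_unit pi M (pullback_fst z) = 0.
  by rewrite -pullbackP z0; exact: (linear0 e).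
move=> /(ext_unit_ker piP)[r [r0 rz]]; exists r; split=> //.
by apply: pullback_eq; rewrite linearZ_LR ?rz// z0 scaler0.
Qed.

Lemma pullback_fst_surj x : exists z, pullback_fst z = x.
Proof.
have [y ey] := e_surj (ext_unit pi M x).
by have [z [<- _]] := pullback_ex ey; exists z.
Qed.

Lemma pullback_fst_ker z : pullback_fst z = 0 -> e (pullback_snd z) = 0.
Proof. by move=> z0; rewrite pullbackP z0; exact: linear0. Qed.

Section Kernel.
Variables (K : lmodType A) (i : {linear K -> Q}).
Hypothesis ei0 : forall k, e (i k) = 0.

Let j0_fun (k : restr_scalars pi K) : M * QR := (0, restr_map pi i k).
Let j0_linear : linear j0_fun.
Proof.
move=> r x y; rewrite /j0_fun linearP; apply: (congr1 (fun z : M => (z, _))).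
by rewrite /= scaler0 addr0.
Qed.
HB.instance Definition _ := GRing.isLinear.Build R (restr_scalars pi K)
  (M * QR)%type *:%R j0_fun j0_linear.

Let hj0 : maps_into_kernel (h_fun : {linear _ -> _}) (j0_fun : {linear _ -> _}).
Proof.
move=> k; apply: etrans (f_equal2
  (fun u v : restr_scalars pi (ext_scalars pi M) => u - v)
  (linear0 (ext_unit pi M)) (ei0 k)) _.
exact: subr0.
Qed.

Definition pullback_ker : {linear restr_scalars pi K -> pullback} := ker_lift hj0.

Lemma pullback_ker_fst k : pullback_fst (pullback_ker k) = 0.
Proof. by rewrite /= /p1_fun ker_liftE. Qed.

Lemma pullback_ker_snd k : pullback_snd (pullback_ker k) = i k.
Proof. by rewrite /= /p2_fun ker_liftE. Qed.

End Kernel.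
End Pullback.

(* With Q -> ext M a flat cover over A with kernel K, its pullback X along
   M -> ext M is R-flat because ext X is Q, and X -> M has kernel K too. *)
Lemma fd_le_of_ext n (M : lmodType R) : fd_le n (ext_scalars pi M) -> fd_le n M.
Proof.
elim: n M => [|n IH] M; first exact: (flat_of_ext piP).
move=> [K [Q [i [e [Qf ii es ek Kn]]]]].
have ei0 k : e (i k) = 0 by apply/ek; exists k.
exists (restr_scalars pi K), (pullback e), (pullback_ker ei0), (pullback_fst e).
split.
- apply: (flat_of_ext piP).
  have [g [_ gK]] := bijective_linear_inv (pullback_ext_bij e).
  have [g' g'K gK'] := pullback_ext_bij e.
  apply: (flat_iso (h := g)) => //.
  exists (ext_lift piP (pullback_snd e)) => // x.
  by apply: (can_inj g'K); rewrite gK.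
- move=> k l kl; apply: ii.
  by rewrite -(pullback_ker_snd ei0) kl pullback_ker_snd.
- exact: pullback_fst_surj.
- move=> z; split=> [z0|[k <-]]; last exact: pullback_ker_fst.
  have /ek[k kE] := pullback_fst_ker z0; exists k; apply: pullback_eq.
    by rewrite z0; exact: pullback_ker_fst.
  by rewrite pullback_ker_snd.
(* The induction hypothesis concerns ext of the restriction of K, which the counit identifies with
   K. *)
- apply: IH; have [g hK gK] := restr_counit_bij K.
  have [g' [hK' gK']] := bijective_linear_inv (restr_counit_bij K).
  apply: (fd_le_iso (h := g')) => //; by exists (restr_counit K).
Qed.

Lemma fd_ext (M : lmodType R) : fd M = fd (ext_scalars pi M).
Proof. by apply: eq_fd => n; split; [exact: fd_le_ext|exact: fd_le_of_ext]. Qed.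

Lemma fd_restr (Q : lmodType A) : fd (restr_scalars pi Q) = fd Q.
Proof.
rewrite fd_ext; apply: eq_fd => n; have bc := restr_counit_bij Q.
have [g [hK gK]] := bijective_linear_inv bc.
split; first exact: fd_le_iso bc.
by apply: (fd_le_iso (h := g)); exists (restr_counit Q).
Qed.

(** A bound over R is tested on restrictions of A-modules, a bound over A on the modules ext M; flat
    dimension is preserved both ways. *)
Lemma wgldim_ext : wgldim R = wgldim A.
Proof.
apply: (congr1 least); apply/funext => n; apply/propext; split=> H M.
  by have [k kE kn] := H (restr_scalars pi M); exists k; rewrite -?fd_restr.
by have [k kE kn] := H (ext_scalars pi M); exists k; rewrite ?fd_ext.
Qed.

End FlatDimensionTransfer.

(** * Balancing *)

Section TensorSquares.
Variable R : comNzRingType.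

Lemma tensor_map_square (M M1 M2 M' N : lmodType R)
    (f : {linear M -> M1}) (f' : {linear M1 -> M'})
    (g : {linear M -> M2}) (g' : {linear M2 -> M'}) (t : tensor M N) :
  (forall x, f' (f x) = g' (g x)) ->
  tensor_map f' idfun (tensor_map f idfun t) =
  tensor_map g' idfun (tensor_map g idfun t).
Proof.
move=> fg; apply: etrans (tensor_map_comp _ _ _ _ _) _.
apply: esym; apply: etrans (tensor_map_comp _ _ _ _ _) _.
by apply: eq_tensor_map => // x; exact: esym (fg x).
Qed.

Lemma tensor_map_zero (M M1 M' N : lmodType R)
    (f : {linear M -> M1}) (f' : {linear M1 -> M'}) (t : tensor M N) :
  (forall x, f' (f x) = 0) -> tensor_map f' idfun (tensor_map f idfun t) = 0.
Proof.
move=> ff0; have E : (tensor_map f' idfun \o tensor_map f idfun : {linear _ -> _}) =1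
    (\0 : {linear tensor M N -> tensor M' N}).
  by apply: tensor_ext => x y; rewrite /= !tensor_mapE ff0 pure0l.
exact: E t.
Qed.

Lemma tensor_map_zeror (M N N1 N' : lmodType R)
    (f : {linear N -> N1}) (f' : {linear N1 -> N'}) (t : tensor M N) :
  (forall x, f' (f x) = 0) -> tensor_map idfun f' (tensor_map idfun f t) = 0.
Proof.
move=> ff0; have E : (tensor_map idfun f' \o tensor_map idfun f : {linear _ -> _}) =1
    (\0 : {linear tensor M N -> tensor M N'}).
  by apply: tensor_ext => x y; rewrite /= !tensor_mapE ff0 pure0r.
exact: E t.
Qed.

Lemma tensor_map_exchange (M M' N N' : lmodType R)
    (f : {linear M -> M'}) (g : {linear N -> N'}) t :
  tensor_map f idfun (tensor_map idfun g t) =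
  tensor_map idfun g (tensor_map f idfun t).
Proof.
apply: etrans (tensor_map_comp _ _ _ _ _) _.
apply: esym; apply: etrans (tensor_map_comp _ _ _ _ _) _.
by apply: eq_tensor_map.
Qed.

Lemma tensor_right_exactr (L K M M' : lmodType R)
    (i : {linear K -> M}) (q : {linear M -> M'}) (t : tensor L M) :
  (forall y, exists x, q x = y) -> (forall x, q x = 0 -> exists k, i k = x) ->
  tensor_map idfun q t = 0 -> exists u, tensor_map idfun i u = t.
Proof.
move=> qs iq qt; have [|u uE] := tensor_right_exact qs iq (t := tensor_swap t).
  by rewrite tensor_map_swap qt linear0.
exists (tensor_swap u); rewrite tensor_map_swap uE; exact: tensor_swapK.
Qed.

(** Flatness of F and G makes both kernels equal to the kernel of K ⊗ L -> F ⊗ G. *)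
Lemma tensor_ker_exchange (K F L G : lmodType R)
    (i : {linear K -> F}) (j : {linear L -> G}) (x : tensor K L) :
  injective i -> injective j -> flat F -> flat G ->
  tensor_map i idfun x = 0 <-> tensor_map idfun j x = 0.
Proof.
move=> ii ji Ff Gf; split=> x0.
- apply: (flat_right Gf ii); rewrite linear0.
  apply: etrans (tensor_map_exchange i j x) _; rewrite x0; exact: linear0.
- apply: (Ff _ _ _ ji); rewrite linear0.
  apply: etrans (esym (tensor_map_exchange i j x)) _; rewrite x0; exact: linear0.
Qed.

End TensorSquares.

(** For an additive u carrying ker a into ker a', as the commuting squares of the applications
    ensure, this says that u induces a bijection between these kernels. *)
Definition bijective_on_kernels (R : pzRingType) (X X' Y Y' : lmodType R)
    (a : {linear X -> Y}) (a' : {linear X' -> Y'}) (u : X -> X') :=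
  (forall x, a x = 0 -> u x = 0 -> x = 0) /\
  (forall x', a' x' = 0 -> exists x, a x = 0 /\ u x = x').

Section Balancing.
Variable R : comNzRingType.
Variables (L G N : lmodType R) (j : {linear L -> G}) (q : {linear G -> N}).
Hypothesis j_inj : injective j.
Hypothesis q_surj : forall y, exists x, q x = y.
Hypothesis jqP : forall x, q x = 0 <-> exists y, j y = x.
Hypothesis G_flat : flat G.

Let qj0 y : q (j y) = 0.
Proof. by apply/jqP; exists y. Qed.

Section Row.
Variables (K F S : lmodType R) (i : {linear K -> F}) (p : {linear F -> S}).
Hypothesis i_inj : injective i.
Hypothesis p_surj : forall y, exists x, p x = y.
Hypothesis ipP : forall x, p x = 0 <-> exists y, i y = x.
Hypothesis F_flat : flat F.

Let pi0 y : p (i y) = 0.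
Proof. by apply/ipP; exists y. Qed.

(* The graph of the snake isomorphism between the kernel of K (x) N -> F (x) N
   and the kernel of S (x) L -> S (x) G: both compute Tor_1 (S, N). *)
Definition balanced (x : tensor K N) (y : tensor S L) :=
  exists (v : tensor K G) (w : tensor F L),
    [/\ tensor_map idfun q v = x, tensor_map i idfun v = tensor_map idfun j w &
        tensor_map p idfun w = y].

Lemma balancedB x y x' y' :
  balanced x y -> balanced x' y' -> balanced (x - x') (y - y').
Proof.
move=> [v [w [<- vw <-]]] [v' [w' [<- vw' <-]]].
exists (v - v'), (w - w'); split; [exact: linearB| |exact: linearB].
apply: etrans (linearB _ _ _) _; rewrite vw vw'; apply: esym; exact: linearB.
Qed.

(** Snake chase: lift x to K ⊗ G; its image in F ⊗ G dies in F ⊗ N, hence comes from F ⊗ L, and is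
    pushed to S ⊗ L. *)
Lemma balanced_ex x : tensor_map i (idfun : {linear N -> N}) x = 0 ->
  exists2 y, balanced x y & tensor_map (idfun : {linear S -> S}) j y = 0.
Proof.
have [v <-] := tensor_map_surj (f := idfun) (fun k => ex_intro _ k erefl) q_surj x.
rewrite tensor_map_exchange => v0.
have [w wE] := tensor_right_exactr q_surj (fun z => (jqP z).1) v0.
exists (tensor_map p idfun w); first by exists v, w.
by rewrite -tensor_map_exchange wE; exact: tensor_map_zero.
Qed.

Lemma balanced_exr y : tensor_map (idfun : {linear S -> S}) j y = 0 ->
  exists2 x, balanced x y & tensor_map i (idfun : {linear N -> N}) x = 0.
Proof.
have [w <-] := tensor_map_surj (g := idfun) p_surj (fun k => ex_intro _ k erefl) y.
rewrite -tensor_map_exchange => w0.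
have [v vE] := tensor_right_exact p_surj (fun z => (ipP z).1) w0.
exists (tensor_map idfun q v); first by exists v, w.
by rewrite tensor_map_exchange vE; exact: tensor_map_zeror.
Qed.

(** If w comes from k in K ⊗ L, flatness of G cancels i and shows that v comes from the same k, so v
    dies in K ⊗ N. The mirror statement below cancels j by flatness of F. *)
Lemma balanced0 x : balanced x 0 -> x = 0.
Proof.
move=> [v [w [<- vw w0]]].
have [k kE] := tensor_right_exact p_surj (fun z => (ipP z).1) w0.
suff -> : v = tensor_map idfun j k by exact: tensor_map_zeror.
apply: (flat_right G_flat i_inj); rewrite vw -kE.
exact: esym (tensor_map_exchange _ _ _).
Qed.

Lemma balanced0l y : balanced 0 y -> y = 0.
Proof.
move=> [v [w [v0 vw <-]]].
have [k kE] := tensor_right_exactr q_surj (fun z => (jqP z).1) v0.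
suff -> : w = tensor_map i idfun k by exact: tensor_map_zero.
apply: (F_flat j_inj); rewrite -vw -kE.
exact: tensor_map_exchange.
Qed.

End Row.

Variables (K F S : lmodType R) (i : {linear K -> F}) (p : {linear F -> S}).
Hypothesis i_inj : injective i.
Hypothesis p_surj : forall y, exists x, p x = y.
Hypothesis ipP : forall x, p x = 0 <-> exists y, i y = x.
Variables (K' F' S' : lmodType R) (i' : {linear K' -> F'}) (p' : {linear F' -> S'}).
Hypothesis i'_inj : injective i'.
Hypothesis p'_surj : forall y, exists x, p' x = y.
Hypothesis ipP' : forall x, p' x = 0 <-> exists y, i' y = x.
Hypothesis F'_flat : flat F'.
Variables (k : {linear K -> K'}) (f : {linear F -> F'}) (h : {linear S -> S'}).
Hypothesis ik : forall x, i' (k x) = f (i x).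
Hypothesis pf : forall x, p' (f x) = h (p x).

Lemma balanced_map x y : balanced i p x y ->
  balanced i' p' (tensor_map k idfun x) (tensor_map h idfun y).
Proof.
move=> [v [w [<- vw <-]]]; exists (tensor_map k idfun v), (tensor_map f idfun w).
split.
- exact: esym (tensor_map_exchange _ _ _).
- rewrite -tensor_map_exchange -vw; exact: tensor_map_square.
- exact: tensor_map_square.
Qed.

(** The relation [balanced] is additive, total and single-valued in the directions used, and
    compatible with the map (k, f, h) of rows. So bijectivity passes from Tor_1 computed by covering
    N to Tor_1 computed by covering S. *)
Lemma balancing :
  bijective_on_kernels (tensor_map (idfun : {linear S -> S}) j)
    (tensor_map (idfun : {linear S' -> S'}) j) (tensor_map h idfun) ->
  bijective_on_kernels (tensor_map i (idfun : {linear N -> N}))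
    (tensor_map i' (idfun : {linear N -> N})) (tensor_map k idfun).
Proof.
move=> [hi hs]; split=> [x x0 kx0|x' x'0].
  have [y xy y0] := balanced_ex ipP x0.
  have := balanced_map xy; rewrite kx0 => /(balanced0l ipP' F'_flat)/(hi _ y0) ye.
  by move: xy; rewrite ye; exact: balanced0.
have [y' xy' y'0] := balanced_ex ipP' x'0; have [y [y0 yE]] := hs _ y'0.
have [x xy x0] := balanced_exr p_surj ipP y0; exists x; split=> //.
have := balancedB (balanced_map xy) xy'; rewrite yE subrr.
by move=> /(balanced0 i'_inj p'_surj ipP')/eqP; rewrite subr_eq0 => /eqP.
Qed.

End Balancing.

(** * The comparison map on Tor *)

Lemma aug_surj (R : comNzRingType) (M : lmodType R) (x : M) : exists u, aug M u = x.
Proof. by exists (basis R x); exact: free_liftE. Qed.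

Lemma aug_exact (R : comNzRingType) (M : lmodType R) (u : freemod R M) :
  aug M u = 0 <-> exists k, ker_incl (aug M) k = u.
Proof.
split=> [u0|[k <-]]; last exact: ker_inclE.
by exists (ker_elt u0); exact: ker_eltK.
Qed.

(** This turns boundaries into a kernel condition: being a boundary in the tensored resolution means
    dying in (syzygy) ⊗ N. *)
Lemma aug_tensor_exact (R : comNzRingType) (M N : lmodType R)
    (z : tensor (freemod R M) N) :
  tensor_map (aug M) idfun z = 0 -> exists u, tensor_map (syz_d M) idfun u = z.
Proof.
move=> z0; have [v <-] := tensor_right_exact (@aug_surj _ M)
  (fun u => (aug_exact u).1) z0.
have [u <-] := tensor_map_surj (f := aug (kermod (aug M)))
  (g := (idfun : {linear N -> N})) (@aug_surj _ _) (fun y => ex_intro _ y erefl) v.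
exists u; apply: esym; apply: etrans (tensor_map_comp _ _ _ _ _) _.
exact: eq_tensor_map.
Qed.

Lemma aug_syz_d (R : comNzRingType) (M : lmodType R) u : aug M (syz_d M u) = 0.
Proof. by rewrite syz_dE; exact: ker_inclE. Qed.

(** * Homology classes and semilinear chain maps *)

Section HomologyClass.
Variables (R : pzRingType) (U V W : lmodType R).
Variables (f : {linear U -> V}) (g : {linear V -> W}).

Local Transparent homology.

Definition homology_class : {linear kermod g -> homology f g} :=
  quot_pi (boundary f g).

Lemma homology_class_surj t : exists x, homology_class x = t.
Proof. by exists (quot_repr (t : quotmod (boundary f g))); exact: quot_reprK. Qed.

Lemma homology_class0 x :
  homology_class x = 0 <-> exists u, f u = ker_incl g x.
Proof.
split=> [/quot_pi_eq0/asboolP//|fx]; apply/quot_pi_eq0; exact/asboolP.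
Qed.

Variables (Q : lmodType R) (h : {linear kermod g -> Q}).
Hypothesis h0 : vanishes_on (boundary f g) h.

Definition homology_lift : {linear homology f g -> Q} := quot_lift h0.

Lemma homology_liftE x : homology_lift (homology_class x) = h x.
Proof. exact: quot_liftE. Qed.

End HomologyClass.
#[global] Opaque homology_class homology_lift.
Arguments homology_class {R U V W} f g.

Section HomologyMapClass.
Variables (R : pzRingType) (U V W U' V' W' : lmodType R).
Variables (f : {linear U -> V}) (g : {linear V -> W}).
Variables (f' : {linear U' -> V'}) (g' : {linear V' -> W'}).
Variables (hU : {linear U -> U'}) (hV : {linear V -> V'}) (hW : {linear W -> W'}).
Hypothesis hf : forall x, f' (hU x) = hV (f x).
Hypothesis hg : forall x, g' (hV x) = hW (g x).

Local Transparent homology homology_map homology_class.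

Lemma homology_map_class x : homology_map hf hg (homology_class f g x) =
  homology_class f' g' (ker_map (homology_ker hg) x).
Proof. exact: quot_mapE. Qed.

End HomologyMapClass.

Section SemilinearKernel.
Variables (R A : comNzRingType) (pi : {rmorphism R -> A}).
Variables (V W : lmodType R) (V' W' : lmodType A).
Variables (g : {linear V -> W}) (g' : {linear V' -> W'}).
Variables (hV : {linear V -> restr_scalars pi V'}).
Variables (hW : {linear W -> restr_scalars pi W'}).
Hypothesis hg : forall x, g' (hV x) = hW (g x).

Lemma semi_ker_subproof (x : kermod g) : g' (hV (ker_incl g x)) = 0.
Proof. by rewrite hg ker_inclE; exact: linear0. Qed.

(** Maps from R-modules to A-modules that are semilinear along pi are encoded as R-linear maps into
    restrictions of scalars. *)
Definition semi_ker_fun (x : kermod g) : restr_scalars pi (kermod g') :=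
  ker_elt (semi_ker_subproof x).

Lemma semi_ker_funE x : ker_incl g' (semi_ker_fun x) = hV (ker_incl g x).
Proof. exact: ker_eltK. Qed.

Lemma semi_ker_linear : linear semi_ker_fun.
Proof.
move=> r x y; apply: (@ker_incl_inj _ _ _ g').
apply: etrans (semi_ker_funE _) _.
apply: etrans (congr1 hV (linearP (ker_incl g) r x y)) _.
apply: etrans (linearP hV r _ _) _.
apply: esym; apply: etrans (linearP (ker_incl g') (pi r) _ _) _.
exact: (f_equal2 (fun u v : V' => pi r *: u + v) (semi_ker_funE x) (semi_ker_funE y)).
Qed.
HB.instance Definition _ := GRing.isLinear.Build R (kermod g)
  (restr_scalars pi (kermod g')) *:%R semi_ker_fun semi_ker_linear.
Definition semi_ker : {linear kermod g -> restr_scalars pi (kermod g')} :=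
  semi_ker_fun.

Lemma semi_kerE x : ker_incl g' (semi_ker x) = hV (ker_incl g x).
Proof. exact: semi_ker_funE. Qed.

Variables (U : lmodType R) (U' : lmodType A).
Variables (f : {linear U -> V}) (f' : {linear U' -> V'}).
Variable hU : {linear U -> restr_scalars pi U'}.
Hypothesis hf : forall x, f' (hU x) = hV (f x).

Lemma semi_homology_vanishes : vanishes_on (boundary f g)
  (restr_map pi (homology_class f' g') \o semi_ker).
Proof.
move=> x /asboolP[u fu]; apply/homology_class0; exists (hU u).
by rewrite hf fu; apply: esym; exact: semi_kerE.
Qed.

Definition semi_homology_map :
    {linear homology f g -> restr_scalars pi (homology f' g')} :=
  homology_lift semi_homology_vanishes.

Lemma semi_homology_map_class x :
  semi_homology_map (homology_class f g x) = homology_class f' g' (semi_ker x).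
Proof. exact: homology_liftE. Qed.

End SemilinearKernel.
#[global] Opaque semi_ker semi_homology_map.

Section SemilinearHomologyNaturality.
Variables (R A : comNzRingType) (pi : {rmorphism R -> A}).
Variables (U1 V1 W1 U2 V2 W2 : lmodType R) (U1' V1' W1' U2' V2' W2' : lmodType A).
Variables (f1 : {linear U1 -> V1}) (g1 : {linear V1 -> W1}).
Variables (f2 : {linear U2 -> V2}) (g2 : {linear V2 -> W2}).
Variables (f1' : {linear U1' -> V1'}) (g1' : {linear V1' -> W1'}).
Variables (f2' : {linear U2' -> V2'}) (g2' : {linear V2' -> W2'}).
Variables (hU : {linear U1 -> U2}) (hV : {linear V1 -> V2}) (hW : {linear W1 -> W2}).
Variables (hU' : {linear U1' -> U2'}) (hV' : {linear V1' -> V2'}).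
Variable hW' : {linear W1' -> W2'}.
Variables (a1U : {linear U1 -> restr_scalars pi U1'}).
Variables (a1V : {linear V1 -> restr_scalars pi V1'}).
Variables (a1W : {linear W1 -> restr_scalars pi W1'}).
Variables (a2U : {linear U2 -> restr_scalars pi U2'}).
Variables (a2V : {linear V2 -> restr_scalars pi V2'}).
Variables (a2W : {linear W2 -> restr_scalars pi W2'}).
Hypothesis hf : forall x, f2 (hU x) = hV (f1 x).
Hypothesis hg : forall x, g2 (hV x) = hW (g1 x).
Hypothesis hf' : forall x, f2' (hU' x) = hV' (f1' x).
Hypothesis hg' : forall x, g2' (hV' x) = hW' (g1' x).
Hypothesis a1f : forall x, f1' (a1U x) = a1V (f1 x).
Hypothesis a1g : forall x, g1' (a1V x) = a1W (g1 x).
Hypothesis a2f : forall x, f2' (a2U x) = a2V (f2 x).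
Hypothesis a2g : forall x, g2' (a2V x) = a2W (g2 x).
Hypothesis ha : forall x, a2V (hV x) = hV' (a1V x).

Lemma semi_homology_map_nat t :
  semi_homology_map a2g a2f (homology_map hf hg t) =
  homology_map hf' hg' (semi_homology_map a1g a1f t).
Proof.
have [x <-] := homology_class_surj t.
rewrite homology_map_class (semi_homology_map_class a1g a1f x).
rewrite (semi_homology_map_class a2g a2f).
apply: etrans (esym (homology_map_class hf' hg' _)).
apply: (congr1 (homology_class f2' g2')); apply: (@ker_incl_inj _ _ _ g2').
apply: etrans (semi_kerE a2g _) _.
apply: etrans (congr1 a2V (ker_mapE (homology_ker hg) x)) _.
apply: etrans (ha _) _; apply: etrans (congr1 hV' (esym (semi_kerE a1g x))) _.
exact: esym (ker_mapE (homology_ker hg') _).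
Qed.

End SemilinearHomologyNaturality.

(** * The chain map from the resolution of M to that of ext M *)

Section ResolutionComparison.
Variables (R A : comNzRingType) (pi : {rmorphism R -> A}).

Section Step.
Variables (S : lmodType R) (S' : lmodType A) (h : {linear S -> restr_scalars pi S'}).

Definition free_semi_map : {linear freemod R S -> restr_scalars pi (freemod A S')} :=
  free_lift (fun x => basis A (h x : S') : restr_scalars pi (freemod A S')).

Lemma free_semi_mapE x : free_semi_map (basis R x) = basis A (h x : S').
Proof. exact: free_liftE. Qed.

Lemma aug_semi_map u : aug S' (free_semi_map u) = h (aug S u).
Proof.
have E : (restr_map pi (aug S') \o free_semi_map : {linear _ -> _}) =1
         (h \o aug S : {linear _ -> _}).
  apply: free_ext => x; apply: etrans (congr1 (aug S') (free_semi_mapE x)) _.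
  apply: etrans (free_liftE (fun y : S' => y) _) _; apply: esym.
  exact: (congr1 h (free_liftE (fun y : S => y) x)).
exact: E u.
Qed.

Definition syz_semi_map :
    {linear kermod (aug S) -> restr_scalars pi (kermod (aug S'))} :=
  semi_ker aug_semi_map.

Lemma syz_semi_mapE x :
  ker_incl (aug S') (syz_semi_map x) = free_semi_map (ker_incl (aug S) x).
Proof. exact: semi_kerE. Qed.

End Step.

Lemma syz_d_semi_map (S : lmodType R) (S' : lmodType A)
    (h : {linear S -> restr_scalars pi S'}) u :
  syz_d S' (free_semi_map (syz_semi_map h) u) = free_semi_map h (syz_d S u).
Proof.
rewrite !syz_dE; apply: etrans (congr1 _ (aug_semi_map _ _)) _.
exact: syz_semi_mapE.
Qed.

Fixpoint syz_ext n (M : lmodType R) :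
    {linear syz n M -> restr_scalars pi (syz n (ext_scalars pi M))} :=
  if n is n'.+1 then syz_semi_map (syz_ext n' M) else ext_unit pi M.

Lemma free_semi_map_nat (S T : lmodType R) (S' T' : lmodType A)
    (h : {linear S -> restr_scalars pi S'}) (k : {linear T -> restr_scalars pi T'})
    (f : {linear S -> T}) (f' : {linear S' -> T'}) u :
  (forall x, k (f x) = f' (h x)) ->
  free_semi_map k (free_map R f u) = free_map A f' (free_semi_map h u).
Proof.
move=> kf.
have E : (free_semi_map k \o free_map R f : {linear _ -> _}) =1
         (restr_map pi (free_map A f') \o free_semi_map h : {linear _ -> _}).
  apply: free_ext => x; rewrite /= free_mapE !free_semi_mapE kf.
  exact: esym (free_mapE _ _ _).
exact: E u.
Qed.

Lemma syz_semi_map_nat (S T : lmodType R) (S' T' : lmodType A)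
    (h : {linear S -> restr_scalars pi S'}) (k : {linear T -> restr_scalars pi T'})
    (f : {linear S -> T}) (f' : {linear S' -> T'}) x :
  (forall x, k (f x) = f' (h x)) ->
  syz_semi_map k (ker_map (aug_map_ker f) x) =
  ker_map (aug_map_ker f') (syz_semi_map h x).
Proof.
move=> kf; apply: (@ker_incl_inj _ _ _ (aug T')).
apply: etrans (syz_semi_mapE _ _) _.
apply: etrans (congr1 (free_semi_map k) (ker_mapE (aug_map_ker f) x)) _.
apply: etrans (free_semi_map_nat (ker_incl _ x) kf) _.
apply: esym; apply: etrans (ker_mapE (aug_map_ker f') (syz_semi_map h x)) _.
exact: (congr1 (free_map A f') (syz_semi_mapE h x)).
Qed.

Lemma syz_ext_map n (M M' : lmodType R) (f : {linear M -> M'}) x :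
  syz_ext n M' (syz_map n f x) = syz_map n (ext_map pi f) (syz_ext n M x).
Proof.
elim: n x => [|n IH] x; first exact: esym (ext_map_unit pi f x).
exact: syz_semi_map_nat IH.
Qed.

Section TensorChain.
Variables (S : lmodType R) (S' : lmodType A) (h : {linear S -> restr_scalars pi S'}).
Variable N : lmodType R.
Local Notation NA := (ext_scalars pi N).

(** Factored so that the only change of ring is the final isomorphism [restr_tensor]; the kernels
    are then compared entirely over R. *)
Definition tensor_chain : {linear tensor (freemod R S) N ->
    restr_scalars pi (tensor (freemod A S') NA)} :=
  restr_tensor pi (freemod A S') N \o tensor_map (free_semi_map h) idfun.

Lemma tensor_chain_def t :
  tensor_chain t =
  restr_tensor pi (freemod A S') N (tensor_map (free_semi_map h) idfun t).
Proof. by []. Qed.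

Lemma tensor_chainE u y : tensor_chain (pure u y) =
  pure (free_semi_map h u : freemod A S') (ext_unit pi N y : NA).
Proof. by rewrite /= tensor_mapE restr_tensorE. Qed.

Lemma tensor_chain_aug t : tensor_map (aug S') idfun (tensor_chain t) =
  restr_tensor pi S' N (tensor_map h idfun (tensor_map (aug S) idfun t)).
Proof.
apply: etrans (esym (restr_tensor_mapl (aug S')
  (tensor_map (free_semi_map h) idfun t))) _.
apply: (congr1 (restr_tensor pi S' N)).
exact: (tensor_map_square (f' := restr_map pi (aug S')) t (aug_semi_map h)).
Qed.

End TensorChain.

Lemma tensor_chain_d (S : lmodType R) (S' : lmodType A)
    (h : {linear S -> restr_scalars pi S'}) (N : lmodType R) t :
  tensor_map (syz_d S') idfun (tensor_chain (syz_semi_map h) N t) =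
  tensor_chain h N (tensor_map (syz_d S) idfun t).
Proof.
have E := tensor_map_square (f' := restr_map pi (syz_d S')) t (syz_d_semi_map h).
apply: etrans (congr1 (tensor_map (syz_d S') idfun) (tensor_chain_def _ _)) _.
apply: esym; apply: etrans (tensor_chain_def _ _) _; rewrite -E.
exact: (restr_tensor_mapl (syz_d S')
  (tensor_map (free_semi_map (syz_semi_map h)) idfun t)).
Qed.

Lemma tensor_chain_nat (S T : lmodType R) (S' T' : lmodType A)
    (h : {linear S -> restr_scalars pi S'}) (k : {linear T -> restr_scalars pi T'})
    (f : {linear S -> T}) (f' : {linear S' -> T'})
    (N N' : lmodType R) (g : {linear N -> N'}) t :
  (forall x, k (f x) = f' (h x)) ->
  tensor_chain k N' (tensor_map (free_map R f) g t) =
  tensor_map (free_map A f') (ext_map pi g) (tensor_chain h N t).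
Proof.
move=> kf.
have E : (tensor_chain k N' \o tensor_map (free_map R f) g : {linear _ -> _}) =1
  (restr_map pi (tensor_map (free_map A f') (ext_map pi g)) \o
   tensor_chain h N : {linear _ -> _}).
  apply: tensor_ext => x y.
  apply: etrans (congr1 (tensor_chain k N') (tensor_mapE _ _ _ _)) _.
  apply: etrans (tensor_chainE _ _ _) _.
  apply: esym; apply: etrans (congr1 (tensor_map (free_map A f') (ext_map pi g))
    (tensor_chainE h x y)) _.
  apply: etrans (tensor_mapE _ _ _ _) _.
  apply: (f_equal2 (fun a b => pure a b)); last exact: ext_map_unit.
  exact: esym (free_semi_map_nat x kf).
exact: E t.
Qed.

Definition tor_chain i (M N : lmodType R) : {linear tensor (res i M) N ->
    restr_scalars pi (tensor (res i (ext_scalars pi M)) (ext_scalars pi N))} :=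
  tensor_chain (syz_ext i M) N.

Lemma tor_chain_d i (M N : lmodType R) t :
  tor_d i (ext_scalars pi M) (ext_scalars pi N) (tor_chain i M N t) =
  tor_chain i.-1 M N (tor_d i M N t).
Proof.
case: i t => [|i] t; first exact: esym (linear0 (tor_chain 0 M N)).
exact: (tensor_chain_d (syz_ext i M) t).
Qed.

Definition Tor_ext i (M N : lmodType R) : {linear Tor i M N ->
    restr_scalars pi (Tor i (ext_scalars pi M) (ext_scalars pi N))} :=
  semi_homology_map (@tor_chain_d i M N) (@tor_chain_d i.+1 M N).

Lemma Tor_ext_map i (M M' N N' : lmodType R)
    (f : {linear M -> M'}) (g : {linear N -> N'}) (t : Tor i M N) :
  Tor_ext i M' N' (Tor_map i f g t) =
  restr_map pi (Tor_map i (ext_map pi f) (ext_map pi g)) (Tor_ext i M N t).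
Proof.
apply: semi_homology_map_nat => z.
exact: (tensor_chain_nat g z (fun x => syz_ext_map (n := i) f x)).
Qed.

End ResolutionComparison.

Lemma linear_sub_scale (R : pzRingType) (V W : lmodType R) (f : {linear V -> W}) r v :
  f (v - r *: v) = f v - r *: f v.
Proof.
apply: etrans (raddfB f _ _) _; apply: (congr1 (fun z => f v - z)).
exact: linearZ_LR.
Qed.

(** * Bijectivity in positive degrees *)

Section TorExtBijective.
Variables (R A : comNzRingType) (pi : {rmorphism R -> A}) (s : {rmorphism A -> R}).
Hypothesis piP : split_by_idempotents pi s.

(** Base of the induction. An x in the kernel that vanishes in ext M ⊗ L is both killed by J and
    fixed by an element of J, hence 0. *)
Lemma ext_unit_bijective_on_kernels (M L G : lmodType R) (j : {linear L -> G}) :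
  injective j ->
  bijective_on_kernels (tensor_map (idfun : {linear M -> M}) j)
    (tensor_map (idfun : {linear restr_scalars pi (ext_scalars pi M) -> _}) j)
    (tensor_map (ext_unit pi M) idfun).
Proof.
move=> ji.
have unit_surj y : exists x, ext_unit pi M x = y by exact: (ext_unit_surj piP y).
have torsion_ker (N : lmodType R) (t : tensor M N) :
    tensor_map (ext_unit pi M) idfun t = 0 -> Jtorsion pi t.
  apply: (Jtorsion_tensor_ker (q := ext_unit pi M)).
    exact: unit_surj.
  by move=> x; exact: (ext_unit_ker piP).
split=> [x jx /torsion_ker xJ|y jy].
  apply: (can_inj (@tensor_swapK _ _ _)); rewrite linear0.
  apply: (Jtorsion_tensor_inj piP ji); last exact: Jtorsion_map.
  by rewrite tensor_map_swap jx linear0.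
have [x xy] := tensor_map_surj (f := ext_unit pi M) (g := (idfun : {linear L -> L}))
  unit_surj (fun l => ex_intro _ l erefl) y.
have [|r [r0 rx]] := @torsion_ker _ (tensor_map idfun j x).
  by rewrite tensor_map_exchange xy.
(* The lift x of y only satisfies j x = r (j x) with r in J; subtracting r x puts it in the kernel
   without changing its image, because r kills ext M ⊗ L. *)
exists (x - r *: x); split.
  apply: etrans (linear_sub_scale (tensor_map idfun j) r x) _.
  by rewrite rx; exact: subrr.
apply: etrans (linear_sub_scale (tensor_map (ext_unit pi M) idfun) r x) _.
rewrite xy.
suff -> : r *: y = 0 by exact: subr0.
move: y {jy xy}; apply: (@tensor_ind _ _ _ (fun y => r *: y = 0)).
  exact: scaler0.
move=> a l t t0; rewrite scalerDr t0 addr0 -pureZl.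
have -> : r *: a = 0 by apply: Jtorsion_restr; exact: (Jtorsion_scale piP a r0).
exact: pure0l.
Qed.

Section Step.
Variables (S : lmodType R) (S' : lmodType A) (h : {linear S -> restr_scalars pi S'}).

(** Both this and the next condition compare Tor_1 of S with Tor_1 of the restriction of S' against
    N; here N is covered by a free module, there S and S' are. *)
Definition bijective_against_covers := forall N : lmodType R,
  bijective_on_kernels (tensor_map (idfun : {linear S -> S}) (ker_incl (aug N)))
    (tensor_map (idfun : {linear restr_scalars pi S' -> _}) (ker_incl (aug N)))
    (tensor_map h idfun).

Definition bijective_on_syzygies := forall N : lmodType R,
  bijective_on_kernels (tensor_map (ker_incl (aug S)) (idfun : {linear N -> N}))
    (tensor_map (restr_map pi (ker_incl (aug S'))) (idfun : {linear N -> N}))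
    (tensor_map (syz_semi_map h) idfun).

Lemma syzygies_of_covers : bijective_against_covers -> bijective_on_syzygies.
Proof.
move=> hc N; pose i' := restr_map pi (ker_incl (aug S')).
pose p' := restr_map pi (aug S').
have i'_inj : injective i' by exact: (@ker_incl_inj _ _ _ (aug S')).
have p'_surj y : exists x, p' x = y by exact: (aug_surj (y : S')).
have ip' x : p' x = 0 <-> exists y, i' y = x by exact: (aug_exact x).
exact: (balancing (@ker_incl_inj _ _ _ (aug N)) (@aug_surj _ N) (@aug_exact _ N)
  (@freemod_flat _ _) (@ker_incl_inj _ _ _ (aug S)) (@aug_surj _ S) (@aug_exact _ S)
  i'_inj p'_surj ip' (flat_restr piP (@freemod_flat _ _))
  (syz_semi_mapE h) (aug_semi_map h) (hc N)).
Qed.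

End Step.

(** Dimension shift: taking the syzygy of N as test module, both kernels live in (syzygy of S) ⊗
    (syzygy of N), where [tensor_ker_exchange] identifies them. *)
Lemma covers_of_syzygies (S : lmodType R) (S' : lmodType A)
    (h : {linear S -> restr_scalars pi S'}) :
  bijective_on_syzygies h -> bijective_against_covers (syz_semi_map h).
Proof.
move=> hb N; have [hi hs] := hb (kermod (aug N)).
have E x : tensor_map (ker_incl (aug S)) idfun x = 0 <->
    tensor_map (idfun : {linear kermod (aug S) -> _}) (ker_incl (aug N)) x = 0.
  by apply: tensor_ker_exchange; [exact: ker_incl_inj|exact: ker_incl_inj
    |exact: freemod_flat|exact: freemod_flat].
have E' x : tensor_map (restr_map pi (ker_incl (aug S'))) idfun x = 0 <->
    tensor_map (idfun : {linear restr_scalars pi (kermod (aug S')) -> _})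
      (ker_incl (aug N)) x = 0.
  apply: tensor_ker_exchange; [exact: (@ker_incl_inj _ _ _ (aug S'))
    |exact: ker_incl_inj
    |exact: (flat_restr piP (@freemod_flat _ _))|exact: freemod_flat].
split=> [x /E x0|x' /E' /hs[x [/E x0 xE]]]; first exact: hi.
by exists x.
Qed.

Lemma syz_ext_bijective n (M : lmodType R) :
  bijective_on_syzygies (syz_ext pi n M).
Proof.
elim: n => [|n IH]; apply: syzygies_of_covers.
  by move=> N; apply: ext_unit_bijective_on_kernels; exact: ker_incl_inj.
exact: covers_of_syzygies.
Qed.

Section Homology.
Variables (S : lmodType R) (S' : lmodType A) (h : {linear S -> restr_scalars pi S'}).
Hypothesis hb : bijective_on_syzygies h.
Variable N : lmodType R.

Local Notation NA := (ext_scalars pi N).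
Local Notation k := (syz_semi_map h).
Local Notation d1 := (tensor_map (syz_d S) (idfun : {linear N -> N})).
Local Notation d2 := (tensor_map (syz_d (kermod (aug S))) (idfun : {linear N -> N})).
Local Notation d1' := (tensor_map (syz_d S') (idfun : {linear NA -> NA})).
Local Notation d2' :=
  (tensor_map (syz_d (kermod (aug S'))) (idfun : {linear NA -> NA})).
Local Notation c := (tensor_chain k N).

Let syz_d_tensor (Q : comNzRingType) (T P : lmodType Q) z :
  tensor_map (syz_d T) (idfun : {linear P -> P}) z =
  tensor_map (ker_incl (aug T)) idfun (tensor_map (aug (kermod (aug T))) idfun z).
Proof.
apply: esym; apply: etrans (tensor_map_comp _ _ _ _ _) _.
exact: eq_tensor_map.
Qed.

(** By [aug_tensor_exact] it suffices that the image of z in (syzygy) ⊗ N is 0. That image dies in F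
    ⊗ N since z is a cycle, and dies on the A side since c z is a boundary. *)
Lemma cycle_inj z u' : d1 z = 0 -> d2' u' = c z -> exists u, d2 u = z.
Proof.
move=> z0 u'z; apply: aug_tensor_exact; apply: (hb N).1.
  by rewrite -syz_d_tensor.
apply: (@restr_tensor_inj _ _ pi s piP); rewrite linear0.
apply: etrans (esym (tensor_chain_aug k z)) _; rewrite -u'z.
apply: tensor_map_zero => x; exact: aug_syz_d.
Qed.

Lemma cycle_surj z' : d1' z' = 0 -> exists z, d1 z = 0 /\
  exists u', d2' u' = c z - z'.
Proof.
rewrite syz_d_tensor => z'0.
have [v vE] := restr_tensor_surj piP (tensor_map (aug (kermod (aug S'))) idfun z').
have [|x [x0 xE]] := (hb N).2 v.
  apply: (@restr_tensor_inj _ _ pi s piP); rewrite linear0.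
  apply: etrans (restr_tensor_mapl (ker_incl (aug S')) v) _.
  by rewrite vE.
have [z zE] := tensor_map_surj (g := (idfun : {linear N -> N}))
  (@aug_surj _ (kermod (aug S))) (fun y => ex_intro _ y erefl) x.
exists z; split; first by rewrite syz_d_tensor zE.
apply: aug_tensor_exact; apply: etrans (linearB _ _ _) _.
apply: etrans (congr1 (fun a => a - _) (tensor_chain_aug k z)) _.
by rewrite zE xE vE; exact: subrr.
Qed.

Lemma semi_homology_map_bij
    (cf : forall x, d2' (tensor_chain (syz_semi_map k) N x) = c (d2 x))
    (cg : forall x, d1' (c x) = tensor_chain h N (d1 x)) :
  bijective (semi_homology_map cg cf).
Proof.
apply: inj_surj_bij.
  apply: raddf_inj => t; have [x <-] := homology_class_surj t => tx.
  apply/homology_class0; have := etrans (esym (semi_homology_map_class cg cf x)) tx.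
  move=> /homology_class0[u' u'E]; apply: (cycle_inj (u' := u')).
    exact: ker_inclE.
  exact: etrans u'E (semi_kerE cg x).
move=> t; have [x' <-] := homology_class_surj (t : homology d2' d1').
have [z [z0 [u' u'E]]] := cycle_surj (ker_inclE x').
exists (homology_class d2 d1 (ker_elt z0)).
apply: etrans (semi_homology_map_class cg cf _) _.
apply/eqP; rewrite -subr_eq0; apply/eqP.
apply: etrans (esym (linearB (homology_class d2' d1') _ _)) _.
apply/homology_class0; exists u'; apply: etrans u'E _.
apply: esym; apply: etrans (linearB (ker_incl d1') _ _) _.
apply: (congr1 (fun a => a - _)); exact: semi_kerE.
Qed.

End Homology.

(** The differential out of degree i + 1 factors through the i + 1-st syzygy, so S is the i-th
    syzygy here; this is where degree 0 drops out. *)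
Lemma Tor_ext_bij i (M N : lmodType R) : bijective (Tor_ext pi i.+1 M N).
Proof. exact: (semi_homology_map_bij (syz_ext_bijective i M)). Qed.

End TorExtBijective.

(** * The ring T(A) *)

Section MaximalIdeal.
Local Open Scope quotient_scope.
Variables (A : comNzRingType) (m : idealr A).
Hypothesis m_max : maximal_ideal m.

(** Otherwise A x + m would be proper, hence inside m. Terms of [idealr] are proper by construction,
    so the denied conclusion is what allows J to be formed. *)
Lemma maximal_ideal_unit (x : A) : x \notin m -> exists a z, z \in m /\ 1 = a * x + z.
Proof.
move=> xm; apply: contrapT => no1; case/negP: xm.
pose I : {pred A} := fun y => `[< exists a z, z \in m /\ y = a * x + z >].
have IP : idealr_closed I.
  split.
  - by apply/asboolP; exists 0, 0; rewrite mul0r addr0 rpred0.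
  - by apply/negP => /asboolP.
  - move=> a u v /asboolP[b [y [ym ->]]] /asboolP[c [z [zm ->]]].
    apply/asboolP; exists (a * b + c), (a * y + z).
    by rewrite rpredD ?idealMr// mulrDr mulrDl mulrA addrACA.
pose Im := isIdealr.Build A I IP; pose J : idealr A := HB.pack I Im.
apply: (m_max (I := J)).
  by move=> y ym; apply/asboolP; exists 0, y; rewrite mul0r add0r.
by apply/asboolP; exists 1, 0; rewrite mul1r addr0 rpred0.
Qed.

Lemma residue0P (x : A) : (residue m x = 0) <-> x \in m.
Proof.
rewrite -(rmorph0 \pi_{ideal_quot m}).
split=> [/eqP|xm]; first by rewrite -Quotient.idealrBE subr0.
by apply/eqP; rewrite -Quotient.idealrBE subr0.
Qed.

Lemma residue_field (u : {ideal_quot m}) : u = 0 \/ exists v, v * u = 1.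
Proof.
elim/quotW: u => x; have [xm|/maximal_ideal_unit[a [z [zm E]]]] := boolP (x \in m).
  by left; apply/residue0P.
right; exists (residue m a); rewrite -[LHS]residueM -[LHS]addr0.
rewrite -((residue0P z).2 zm) -[LHS](rmorphD \pi_{ideal_quot m}) -E.
exact: rmorph1.
Qed.

End MaximalIdeal.

Section DiagonalSequences.
Local Open Scope quotient_scope.
Variables (A : comNzRingType) (m : idealr A).
Local Notation R := (TA m).
Local Notation k := {ideal_quot m}.
Local Notation pi := (TA_proj m).

Definition TA_coord (i : nat) (x : R) : k := (val (x : TA_type m)).2 i.

Lemma TA_eq (x y : R) :
  pi x = pi y -> (forall i, TA_coord i x = TA_coord i y) -> x = y.
Proof.
move=> xy1 xy2; apply: (val_inj : injective (val : TA_type m -> _)).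
rewrite [LHS]surjective_pairing [RHS]surjective_pairing.
by apply: (f_equal2 pair) => //; apply/funext.
Qed.

Lemma TA_coordD i x y : TA_coord i (x + y) = TA_coord i x + TA_coord i y.
Proof. by []. Qed.

Lemma TA_coordM i x y : TA_coord i (x * y) = TA_coord i x * TA_coord i y.
Proof. by []. Qed.

Lemma TA_coord_sum i (I : Type) (l : seq I) (F : I -> R) :
  TA_coord i (\sum_(j <- l) F j) = \sum_(j <- l) TA_coord i (F j).
Proof. exact: (big_morph (TA_coord i) (TA_coordD i) erefl). Qed.

Lemma TA_finite (x : R) : finite_set [set i | TA_coord i x <> residue m (pi x)]%classic.
Proof. by have /asboolP := valP (x : TA_type m). Qed.

Lemma TA_exists (a : A) (c : nat -> k) :
  finite_set [set i | c i <> residue m a]%classic ->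
  exists x : R, pi x = a /\ forall i, TA_coord i x = c i.
Proof.
move=> fc; have xP : (a, c) \in @TA_pred A m by apply/asboolP.
by exists (Sub (a, c) xP : TA_type m); rewrite /TA_proj/= /TA_proj_fun /TA_coord SubK.
Qed.

Lemma TA_diag_subproof a : (a, fun=> residue m a) \in @TA_pred A m.
Proof.
apply/asboolP; rewrite (_ : deviation _ = set0)//.
by apply/seteqP; split=> // i /=; apply.
Qed.

Definition TA_diag_fun (a : A) : R :=
  Sub (a, fun=> residue m a) (TA_diag_subproof a) : TA_type m.

Lemma TA_diag_coord i a : TA_coord i (TA_diag_fun a) = residue m a.
Proof. by []. Qed.

Lemma TA_diag_zmod : zmod_morphism TA_diag_fun.
Proof.
by move=> a b; apply: TA_eq => // i; exact: residueB.
Qed.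
Lemma TA_diag_monoid : monoid_morphism TA_diag_fun.
Proof.
split; first by apply: TA_eq => // i; exact: (rmorph1 \pi_{ideal_quot m}).
by move=> a b; apply: TA_eq => // i; exact: residueM.
Qed.
HB.instance Definition _ := GRing.isZmodMorphism.Build A R TA_diag_fun TA_diag_zmod.
HB.instance Definition _ := GRing.isMonoidMorphism.Build A R TA_diag_fun TA_diag_monoid.
Definition TA_diag : {rmorphism A -> R} := TA_diag_fun.

Hypothesis m_max : maximal_ideal m.

Lemma TA_support_finite (r : R) : pi r = 0 ->
  finite_set [set i | TA_coord i r <> 0]%classic.
Proof.
move=> r0; have := TA_finite r; rewrite r0.
by rewrite (_ : residue m 0 = 0)//; exact: (rmorph0 \pi_{ideal_quot m}).
Qed.

Lemma TA_indicator (D : set nat) : finite_set D ->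
  exists e : R, pi e = 0 /\ forall i, TA_coord i e = (if `[< D i >] then 1 else 0).
Proof.
move=> fD; apply: TA_exists; apply: sub_finite_set fD => i /=.
rewrite (_ : residue m 0 = 0); last exact: (rmorph0 \pi_{ideal_quot m}).
by case: asboolP.
Qed.

Lemma TA_indicator1_field (e : R) i : pi e = 0 ->
  (forall j, TA_coord j e = (if j == i then 1 else 0)) -> field_idempotent e.
Proof.
move=> e0 eE; split.
  apply: TA_eq => [|j]; first by rewrite rmorphM e0 mulr0.
  by rewrite TA_coordM eE; case: eqP; rewrite ?mulr1 ?mulr0.
move=> a; have [ai|[v vai]] := residue_field m_max (TA_coord i a).
  left; apply: TA_eq => [|j]; first by rewrite rmorphM e0 mulr0 rmorph0.
  by rewrite TA_coordM eE; case: eqP => [->|_]; rewrite ?ai ?mul0r ?mulr0.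
(* The inverse v in the residue field is realized in the ring as the constant sequence of a lift of
   v; only its i-th coordinate matters. *)
right; exists (TA_diag (repr v)).
apply: TA_eq => [|j]; first by rewrite !rmorphM e0 !mulr0.
rewrite !TA_coordM eE; case: eqP => [->|_]; last by rewrite !mulr0.
by rewrite mulr1 TA_diag_coord /residue reprK.
Qed.

(** Elements of J are the finitely supported sequences. The indicator of the support is a local
    unit, and the indicators of its points are the field idempotents of the decomposition. *)
Lemma TA_split : split_by_idempotents pi TA_diag.
Proof.
split=> [//|r r0|r r0].
  have [e [e0 eE]] := TA_indicator (TA_support_finite r0); exists e; split=> //.
  apply: TA_eq => [|i]; first by rewrite rmorphM e0 r0 mulr0.
  rewrite TA_coordM eE; case: asboolP => [_|/contrapT ->]; first exact: mul1r.
  exact: mulr0.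
have [X XE] := finite_fsetP.1 (TA_support_finite r0).
have dex i : exists e : R, pi e = 0 /\
    forall j, TA_coord j e = (if j == i then 1 else 0).
  have [e [e0 eE]] := TA_indicator (finite_set1 i); exists e; split=> // j.
  by rewrite eE; case: asboolP => [->|/eqP/negbTE->//]; rewrite eqxx.
pose d i := sval (cid (dex i)).
have dP i : pi (d i) = 0 /\ _ := svalP (cid (dex i)).
exists [seq d i | i <- X]; split.
  move=> _ /mapP[i _ ->]; have [d0 dE] := dP i; exact: TA_indicator1_field d0 dE.
rewrite big_map; apply: TA_eq => [|i].
  by rewrite r0 rmorph_sum big1// => i _; rewrite rmorphM r0 mul0r.
rewrite TA_coord_sum; have [iX|iX] := boolP (i \in (X : seq nat)).
  rewrite (bigD1_seq i) ?fset_uniq// TA_coordM (dP i).2 eqxx mulr1 big1.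
    exact: esym (addr0 _).
  by move=> j ji; rewrite TA_coordM (dP j).2 eq_sym (negbTE ji) mulr0.
have -> : TA_coord i r = 0.
  apply: contrapT => ri; have : [set` X]%classic i by rewrite -XE.
  by move=> /= iX'; move: iX; rewrite iX'.
rewrite big_seq big1// => j jX; rewrite TA_coordM (dP j).2.
by case: eqP => [ij|_]; rewrite ?mulr0// ij jX in iX *.
Qed.

End DiagonalSequences.

Theorem theorem5p3 (A : comNzRingType) (m : idealr A) (A_local : local_ring m) :
  let R := TA m in
  let pi : {rmorphism R -> A} := TA_proj m in
  [/\ forall i : nat, (1 <= i)%N ->
        exists phi : forall M N : lmodType R,
            {linear Tor i M N ->
               restr_scalars pi (Tor i (ext_scalars pi M) (ext_scalars pi N))},
          (forall M N : lmodType R, bijective (phi M N)) /\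
          (forall (M M' N N' : lmodType R)
                  (f : {linear M -> M'}) (g : {linear N -> N'}) (t : Tor i M N),
            phi M' N' (Tor_map i f g t)
            = restr_map pi (Tor_map i (ext_map pi f) (ext_map pi g)) (phi M N t)),
      forall M : lmodType R, fd M = fd (ext_scalars pi M) &
      wgldim R = wgldim A].
Proof.
move=> R pi; have piP := TA_split A_local.1; split.
- move=> [//|i] _; exists (Tor_ext pi i.+1); split.
  + move=> M N; exact: Tor_ext_bij piP i M N.
  + exact: Tor_ext_map.
- exact: fd_ext piP.
- exact: wgldim_ext piP.
Qed.
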